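(* Let $P=P(d,\mathbf m)$ and let $I\subset P$ be a color-squarefree monomial ideal. Put $I'=I+\mathfrak m_1^{[2]}+\cdots+\mathfrak m_d^{[2]}$. Then: (a) There is an exact sequence of $\mathbb Z^{|\mathbf m|}$-graded $P$-modules $$0\to F_d\to\cdots\to F_1\to F_0=P/I'\to P/\Big(I+\sum_{i=1}^d\mathfrak m_i^2\Big)\to0,$$ where $$F_k=\bigoplus_{u\in[\mathrm{Mon}_{\mathrm{c\text{-}sqfree}}(P)]_k}\big(P/(I':u)\big)(-2\deg(u)),$$ and the maps are induced by the Koszul maps for the regular sequence of the $|\mathbf m|$ squares $x_{1,1}^2,x_{1,2}^2,\dots,x_{d,m_d}^2$. (b) $P/(I+\sum_{i=1}^d\mathfrak m_i^2)$ is minimally resolved over $P$ by iterated mapping cones from the exact sequence in (a). (c) The $\mathbb Z^{|\mathbf m|}$-graded Betti numbers of $P/(I+\sum_{i=1}^d\mathfrak m_i^2)$ are $$\beta_{k,a}\Big(P/\big(I+\sum_{i=1}^d\mathfrak m_i^2\big)\Big)=\sum_{j=0}^d\ \sum_{u\in[\mathrm{Mon}_{\mathrm{c\text{-}sqfree}}(P)]_j}\beta_{k-j,\,a-2\deg(u)}\big(P/(I':u)\big).$$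
   Context: $P(d,\mathbf m)$, $d\ge1$, $\mathbf m=(m_1,\dots,m_d)\in\mathbb N^d$, is the polynomial ring over a field $\mathbb K$ in variables $x_{i,j}$, $1\le i\le d$, $1\le j\le m_i$; $x_{i,j}$ has color $i$; $|\mathbf m|=m_1+\dots+m_d$. It carries the fine $\mathbb Z^{|\mathbf m|}$-grading in which each variable has degree a standard basis vector. $\mathfrak m_i=(x_{i,1},\dots,x_{i,m_i})$ and $\mathfrak m_i^{[2]}=(x_{i,j}x_{i,k}:1\le j<k\le m_i)$. A monomial is color-squarefree if it is squarefree and divisible by at most one variable of each color; $[\mathrm{Mon}_{\mathrm{c\text{-}sqfree}}(P)]_k$ is the set of color-squarefree monomials of $P$ of total degree $k$. A monomial ideal is color-squarefree if its minimal monomial generators are. The Koszul complex of the squares has basis elements $e_u$ indexed by squarefree monomials $u$, with $e_u\mapsto\sum_{x\mid u}\pm x^2e_{u/x}$ (usual Koszul signs); ''induced'' means the maps obtained on the quotients $P/(I':u)$ of the summands, where $I':u=P$ if the squarefree monomial $u$ is not color-squarefree. ''Minimally resolved by iterated mapping cones'' means: breaking the exact sequence into short exact sequences and successively forming mapping cones of lifted comparison maps, starting with minimal graded free resolutions of the modules $F_k$, yields a minimal graded free resolution of the last module. $\beta_{k,a}(M)=\dim_{\mathbb K}[\mathrm{Tor}_k^{P}(M,\mathbb K)]_a$, zero for $k<0$. *)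

(* Defs.v *)
From HB Require Import structures.
From Stdlib Require Import ClassicalEpsilon.
From mathcomp Require Import all_boot all_order all_algebra.
From mathcomp Require Import boolp.
From mathcomp Require Import mpoly.

Set Implicit Arguments.
Unset Strict Implicit.
Unset Printing Implicit Defensive.

Import GRing.Theory.

Local Open Scope ring_scope.
Local Open Scope quotient_scope.

Definition zdeg (n : nat) := {ffun 'I_n -> int}.
HB.instance Definition _ n := GRing.Zmodule.on (zdeg n).

Definition deg_mon (n : nat) (u : 'X_{1..n}) : zdeg n :=
  [ffun v => (u v)%:Z].

Lemma deg_monD n (u w : 'X_{1..n}) :
  deg_mon (u + w)%MM = deg_mon u + deg_mon w.
Proof. by apply/ffunP => v; rewrite !ffunE mnmDE PoszD. Qed.

Lemma deg_mon_inj n : injective (@deg_mon n).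
Proof.
move=> u w /ffunP uw; apply/mnmP => v.
by have := uw v; rewrite !ffunE => -[].
Qed.

Definition mhomog (K : fieldType) (n : nat) (a : zdeg n) (p : {mpoly K[n]}) :=
  forall u, u \in msupp p -> deg_mon u = a.

Section MonomialIdeals.
Variables (K : fieldType) (n : nat).
Local Notation P := {mpoly K[n]}.

Definition mon_span (G : 'X_{1..n} -> Prop) (p : P) : Prop :=
  exists s : seq (P * 'X_{1..n}),
    (forall x, x \in s -> G x.2) /\ p = \sum_(x <- s) x.1 * 'X_[x.2].

Record monIdeal := MonIdeal {
  mi_set :> P -> Prop;
  mi_monomial : exists G, forall p, mi_set p <-> mon_span G p }.

Lemma mon_spanP G (p : P) :
  mon_span G p <->
  (forall u, u \in msupp p -> exists2 g, G g & (g <= u)%MM).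
Proof.
split=> [[s [sG ->]] u|pG].
  elim: s sG => [|x s IH] sG; first by rewrite big_nil msupp0.
  rewrite big_cons => /msuppD_le; rewrite mem_cat => /orP[|].
    rewrite (perm_mem (msuppMX _ _)) => /mapP[w _ ->]; exists x.2; last exact: lem_addr.
    by apply: sG; rewrite mem_head.
  by apply: IH => y ys; apply: sG; rewrite in_cons ys orbT.
have [h hP] : exists h : 'X_{1..n} -> 'X_{1..n},
    forall u, u \in msupp p -> G (h u) /\ (h u <= u)%MM.
  exists (fun u => epsilon (inhabits u) (fun g => G g /\ (g <= u)%MM)) => u up.
  apply: (epsilon_spec (inhabits u) (fun g => G g /\ (g <= u)%MM)).
  by have [g Gg gu] := pG u up; exists g.
exists [seq (p@_u *: 'X_[u - h u], h u) | u <- msupp p].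
split=> [x /mapP[u /hP[Gu _] ->] //|].
rewrite big_map [LHS]mpolyE big_seq [RHS]big_seq; apply: eq_bigr => u /hP[_ hu].
by rewrite -scalerAl -mpolyXD submK.
Qed.

Lemma monIdealP (J : monIdeal) (p : P) :
  J p <-> (forall u, u \in msupp p -> J 'X_[u]).
Proof.
case: J => J [G JG] /=; rewrite JG mon_spanP; split=> H u /[dup] up /H.
  move=> [g Gg gu]; rewrite JG mon_spanP => w; rewrite msuppX inE => /eqP ->.
  by exists g.
by rewrite JG mon_spanP; apply; rewrite msuppX inE.
Qed.

Lemma mi0 (J : monIdeal) : J 0.
Proof. by apply/monIdealP => u; rewrite msupp0. Qed.

Lemma miD (J : monIdeal) p q : J p -> J q -> J (p + q).
Proof.
move=> /monIdealP Jp /monIdealP Jq; apply/monIdealP => u.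
by move=> /msuppD_le; rewrite mem_cat => /orP[/Jp|/Jq].
Qed.

Lemma miM (J : monIdeal) p q : J q -> J (p * q).
Proof.
case: J => J [G JG] /=; rewrite !JG => -[s [sG ->]].
exists [seq (p * x.1, x.2) | x <- s]; split=> [x /mapP[y /sG Gy ->] //|].
by rewrite big_map mulr_sumr; apply: eq_bigr => x _; rewrite mulrA.
Qed.

Lemma miN (J : monIdeal) p : J p -> J (- p).
Proof. by rewrite -mulN1r; apply: miM. Qed.

Definition mi_of (G : 'X_{1..n} -> Prop) : monIdeal :=
  MonIdeal (ex_intro _ G (fun p => iff_refl (mon_span G p))).

Lemma mi_intro (S : P -> Prop) :
    (forall p, S p <-> (forall u, u \in msupp p -> S 'X_[u])) ->
    (forall u w, S 'X_[u] -> S 'X_[w + u]) ->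
  exists G, forall p, S p <-> mon_span G p.
Proof.
move=> S1 S2; exists (fun u => S 'X_[u]) => p; rewrite S1 mon_spanP.
split=> H u /H; first by exists u => //; apply: lepm_refl.
by move=> [g Sg gu]; rewrite -(submK gu); apply: S2.
Qed.

Definition mi_add (I J : monIdeal) : monIdeal.
Proof.
exists (fun p => exists q r, [/\ I q, J r & p = q + r]).
have [[G IG] [H JH]] := (mi_monomial I, mi_monomial J).
exists (fun u => G u \/ H u) => p; split.
  move=> [q [r [/IG[s [sG ->]] /JH[t [tH ->]] ->]]].
  exists (s ++ t); rewrite big_cat; split=> // x; rewrite mem_cat.
  by move=> /orP[/sG|/tH]; [left|right].
move=> [s [sGH ->]]; elim: s sGH => [|x s IH] sGH.
  by exists 0, 0; rewrite big_nil addr0; split=> //; apply: mi0.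
case: IH => [y ys|q [r [Iq Jr E]]].
  by apply: sGH; rewrite in_cons ys orbT.
rewrite big_cons E; case: (sGH x); first by rewrite mem_head.
  move=> Gx; exists (x.1 * 'X_[x.2] + q), r; split=> //; last by rewrite addrA.
  apply: miD Iq; apply: miM; apply/IG; exists [:: (1, x.2)]; split.
    by move=> y; rewrite inE => /eqP ->.
  by rewrite big_seq1 mul1r.
move=> Hx; exists q, (x.1 * 'X_[x.2] + r); split=> //; last by rewrite addrCA.
apply: miD Jr; apply: miM; apply/JH; exists [:: (1, x.2)]; split.
  by move=> y; rewrite inE => /eqP ->.
by rewrite big_seq1 mul1r.
Defined.

(* The product of two monomial ideals is generated by the products of their
   monomials. *)
Definition mi_mul (I J : monIdeal) : monIdeal :=
  mi_of (fun u => exists g h, [/\ I 'X_[g], J 'X_[h] & u = (g + h)%MM]).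

Definition mi_colon (I : monIdeal) (u : 'X_{1..n}) : monIdeal.
Proof.
exists (fun p => I (p * 'X_[u])); apply: mi_intro => [p|w v].
  split=> [/monIdealP Ip w wp|Ip].
    rewrite -mpolyXD; apply: Ip; rewrite (perm_mem (msuppMX _ _)); apply/mapP.
    by exists w => //; rewrite addmC.
  apply/monIdealP => w; rewrite (perm_mem (msuppMX _ _)) => /mapP[v /Ip Iv ->].
  by rewrite addmC mpolyXD.
by rewrite mpolyXD -mulrA; apply: miM.
Defined.

Definition min_generator (I : monIdeal) (u : 'X_{1..n}) : Prop :=
  I 'X_[u] /\ (forall w, I 'X_[w] -> (w <= u)%MM -> w = u).

End MonomialIdeals.

Section GradedModules.
Variables (K : fieldType) (n : nat).
Local Notation P := {mpoly K[n]}.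

Record grModule := GrModule {
  gm_sort :> lmodType P;
  gm_hom : zdeg n -> gm_sort -> Prop;
  gm_hom0 : forall a, gm_hom a 0;
  gm_homD : forall a x y, gm_hom a x -> gm_hom a y -> gm_hom a (x + y);
  gm_homZ : forall a b (p : P) x,
    mhomog b p -> gm_hom a x -> gm_hom (b + a) (p *: x);
  gm_sum : forall x, exists (s : seq (zdeg n)) (f : zdeg n -> gm_sort),
    (forall a, gm_hom a (f a)) /\ x = \sum_(a <- s) f a;
  gm_indep : forall (s : seq (zdeg n)) (f : zdeg n -> gm_sort),
    uniq s -> (forall a, gm_hom a (f a)) -> \sum_(a <- s) f a = 0 ->
    forall a, a \in s -> f a = 0 }.

Definition gr_map (M N : grModule) (f : M -> N) : Prop :=
  forall a x, gm_hom a x -> gm_hom a (f x).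

(* M(b), with [M(b)]_a = M_(a+b) *)
Definition gm_shift (M : grModule) (b : zdeg n) : grModule.
Proof.
exists M (fun a x => gm_hom (a + b) x).
- by move=> a; apply: gm_hom0.
- by move=> a; apply: gm_homD.
- by move=> a c p x pc xa; rewrite -addrA; apply: gm_homZ.
- move=> x; have [s [f [fh ->]]] := gm_sum x.
  exists [seq a - b | a <- s], (fun a => f (a + b)); split=> [a|]; first exact: fh.
  by rewrite big_map; apply: eq_bigr => a _; rewrite subrK.
- move=> s f us fh s0 a sa; rewrite -[a](addrK b).
  apply: (gm_indep (s := [seq c + b | c <- s]) (f := fun c => f (c - b))).
  + by rewrite map_inj_uniq //; apply: addIr.
  + by move=> c; have := fh (c - b); rewrite subrK.
  + by rewrite big_map -[RHS]s0; apply: eq_bigr => c _; rewrite addrK.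
  + exact: map_f.
Defined.

Section Quotient.
Variable J : monIdeal K n.

Definition qrel (p q : P) : bool := `[< J (p - q) >].

Lemma qrel_refl : reflexive qrel.
Proof. by move=> p; apply/asboolP; rewrite subrr; apply: mi0. Qed.

Lemma qrel_sym : ssrbool.symmetric qrel.
Proof. by move=> p q; apply/asboolP/asboolP => /miN; rewrite opprB. Qed.

Lemma qrel_trans : transitive qrel.
Proof.
move=> q p r /asboolP pq /asboolP qr; apply/asboolP.
by have := miD pq qr; rewrite addrA subrK.
Qed.

Canonical qrel_equiv := EquivRel qrel qrel_refl qrel_sym qrel_trans.

Definition mquot := {eq_quot qrel_equiv}.
HB.instance Definition _ := Choice.on mquot.
HB.instance Definition _ := EqQuotient.on mquot.

Definition mclass (p : P) : mquot := \pi_mquot p.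

Lemma mclassP p q : mclass p = mclass q <-> J (p - q).
Proof. by split=> [/eqmodP/asboolP|Jpq] //; apply/eqmodP/asboolP. Qed.

Lemma mclassK x : mclass (repr x) = x.
Proof. exact: reprK. Qed.

Definition mquot_add (x y : mquot) := mclass (repr x + repr y).
Definition mquot_opp (x : mquot) := mclass (- repr x).
Definition mquot_scale (p : P) (x : mquot) := mclass (p * repr x).

Lemma mclass_repr p : J (p - repr (mclass p)).
Proof. by apply/mclassP; rewrite mclassK. Qed.

Lemma mclassD p q : mquot_add (mclass p) (mclass q) = mclass (p + q).
Proof.
apply/esym/mclassP; rewrite opprD addrACA.
exact: miD (mclass_repr p) (mclass_repr q).
Qed.

Lemma mclassN p : mquot_opp (mclass p) = mclass (- p).
Proof. by apply/esym/mclassP; rewrite -opprD; apply/miN/mclass_repr. Qed.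

Lemma mclassZ p q : mquot_scale p (mclass q) = mclass (p * q).
Proof. by apply/esym/mclassP; rewrite -mulrBr; apply/miM/mclass_repr. Qed.

Lemma mquotW (Q : mquot -> Prop) : (forall p, Q (mclass p)) -> forall x, Q x.
Proof. by move=> H x; rewrite -[x]mclassK. Qed.

Lemma mquot_addA : associative mquot_add.
Proof.
by elim/mquotW => p; elim/mquotW => q; elim/mquotW => r; rewrite !mclassD addrA.
Qed.

Lemma mquot_addC : commutative mquot_add.
Proof. by elim/mquotW => p; elim/mquotW => q; rewrite !mclassD addrC. Qed.

Lemma mquot_add0 : left_id (mclass 0) mquot_add.
Proof. by elim/mquotW => p; rewrite !mclassD add0r. Qed.

Lemma mquot_addN : left_inverse (mclass 0) mquot_opp mquot_add.
Proof. by elim/mquotW => p; rewrite mclassN mclassD addNr. Qed.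

HB.instance Definition _ :=
  GRing.isZmodule.Build mquot mquot_addA mquot_addC mquot_add0 mquot_addN.

Lemma mclass_add p q : mclass p + mclass q = mclass (p + q).
Proof. exact: mclassD. Qed.

Lemma mquot_scaleA p q x :
  mquot_scale p (mquot_scale q x) = mquot_scale (p * q) x.
Proof. by elim/mquotW: x => r; rewrite !mclassZ mulrA. Qed.

Lemma mquot_scale1 : left_id 1 mquot_scale.
Proof. by elim/mquotW => r; rewrite mclassZ mul1r. Qed.

Lemma mquot_scaleDr : right_distributive mquot_scale +%R.
Proof.
move=> p; elim/mquotW => q; elim/mquotW => r.
by rewrite mclass_add !mclassZ mclass_add mulrDr.
Qed.

Lemma mquot_scaleDl x : {morph mquot_scale^~ x : p q / p + q}.
Proof.
by elim/mquotW: x => r p q; rewrite !mclassZ mclass_add mulrDl.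
Qed.

HB.instance Definition _ := GRing.Zmodule_isLmodule.Build P mquot
  mquot_scaleA mquot_scale1 mquot_scaleDr mquot_scaleDl.

Lemma mclass_linear : linear (mclass : P^o -> mquot).
Proof.
move=> c p q.
by rewrite -[c *: mclass p]/(mquot_scale c (mclass p)) mclassZ mclass_add.
Qed.
HB.instance Definition _ := 
  GRing.isLinear.Build P P^o mquot *:%R mclass mclass_linear.

Definition mquot_hom (a : zdeg n) (x : mquot) : Prop :=
  exists2 p, mhomog a p & x = mclass p.

End Quotient.

Lemma mhomog0 (a : zdeg n) : mhomog a (0 : P).
Proof. by move=> u; rewrite msupp0. Qed.

Lemma mhomogD (a : zdeg n) (p q : P) :
  mhomog a p -> mhomog a q -> mhomog a (p + q).
Proof. by move=> pa qa u /msuppD_le; rewrite mem_cat => /orP[/pa|/qa]. Qed.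

Lemma mhomogM (a b : zdeg n) (p q : P) :
  mhomog a p -> mhomog b q -> mhomog (a + b) (p * q).
Proof.
by move=> pa qb u /msuppM_le/allpairsP[[v w] /= [/pa <- /qb <- ->]]; rewrite deg_monD.
Qed.

Lemma mhomog_term (c : K) (u : 'X_{1..n}) : mhomog (deg_mon u) (c *: 'X_[u]).
Proof. by move=> v /msuppZ_le; rewrite msuppX inE => /eqP ->. Qed.

(* A homogeneous element of P is a scalar multiple of a monomial. *)
Lemma mhomog_coef (a : zdeg n) (p : P) u :
  mhomog a p -> p@_u != 0 -> deg_mon u = a /\ p = p@_u *: 'X_[u].
Proof.
move=> pa pu; have ua : deg_mon u = a by apply: pa; rewrite mcoeff_msupp.
split=> //; apply/mpolyP => v; rewrite mcoeffZ mcoeffX.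
have [<-|uv] := eqVneq u v; first by rewrite mulr1.
rewrite mulr0; apply/eqP; apply: contraNT uv => pv.
by apply/eqP/deg_mon_inj; rewrite ua pa // mcoeff_msupp.
Qed.

Definition gm_quot (J : monIdeal K n) : grModule.
Proof.
exists (mquot J) (@mquot_hom J).
- by move=> a; exists 0; [apply: mhomog0|].
- move=> a _ _ [p pa ->] [q qa ->]; exists (p + q); first exact: mhomogD.
  exact: mclassD.
- move=> a b p _ pb [q qa ->]; exists (p * q); first exact: mhomogM.
  exact: mclassZ.
- elim/mquotW => p.
  exists [seq deg_mon u | u <- msupp p].
  have [f fP] : exists f : zdeg n -> P, forall a, mhomog a (f a) /\
      (forall u, u \in msupp p -> deg_mon u = a -> f a = p@_u *: 'X_[u]).
    pose Q a q := mhomog a q /\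
      (forall u, u \in msupp p -> deg_mon u = a -> q = p@_u *: 'X_[u]).
    exists (fun a => epsilon (inhabits 0) (Q a)) => a.
    apply: (epsilon_spec (inhabits 0) (Q a)).
    have [[u up <-]|no] := EM (exists2 u, u \in msupp p & deg_mon u = a).
      exists (p@_u *: 'X_[u]); split=> [|v vp /deg_mon_inj ->] //.
      exact: mhomog_term.
    by exists 0; split=> [|u up ua]; [exact: mhomog0|case: no; exists u].
  exists (fun a => mclass J (f a)); split=> [a|].
    by exists (f a) => //; case: (fP a).
  rewrite big_map {1}[p]mpolyE raddf_sum big_seq [RHS]big_seq.
  by apply: eq_bigr => u up; congr mclass; rewrite ((fP _).2 u).
- move=> s f us fh s0 a sa.
  have [g gP] : exists g : zdeg n -> P, forall a, mhomog a (g a) /\ f a = mclass J (g a).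
    exists (fun a => epsilon (inhabits 0) (fun q => mhomog a q /\ f a = mclass J q)).
    move=> b; apply: (epsilon_spec (inhabits 0) (fun q => mhomog b q /\ f b = mclass J q)).
    by have [q] := fh b; exists q.
  have Jg : J (\sum_(b <- s) g b).
    rewrite -[X in J X]subr0; apply/mclassP.
    rewrite [RHS]raddf0 raddf_sum -[RHS]s0; apply: eq_bigr => b _.
    by rewrite (gP b).2.
  rewrite (gP a).2 -[RHS](raddf0 (mclass J)); apply/mclassP; rewrite subr0.
  apply/monIdealP => u; rewrite mcoeff_msupp => gu.
  have [ua _] := mhomog_coef (gP a).1 gu.
  move/monIdealP: Jg; apply; rewrite mcoeff_msupp raddf_sum /=.
  rewrite (bigD1_seq a) //= big1 ?addr0 // => b ba.
  apply/eqP; apply: contraNT ba => gbu.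
  by have [<- _] := mhomog_coef (gP b).1 gbu; rewrite ua.
Defined.

Section DirectSum.
Variables (U : finType) (M : U -> grModule).

Definition dsum_sort := {dffun forall u : U, M u}.
HB.instance Definition _ := Choice.on dsum_sort.
Implicit Types x y z : dsum_sort.

Definition dsum_zero : dsum_sort := [ffun u => 0 : M u].
Definition dsum_add x y : dsum_sort := [ffun u => x u + y u].
Definition dsum_opp x : dsum_sort := [ffun u => - x u].
Definition dsum_scale (p : P) x : dsum_sort := [ffun u => p *: x u].

Lemma dsum_addA : associative dsum_add.
Proof. by move=> x y z; apply/ffunP => u; rewrite !ffunE addrA. Qed.
Lemma dsum_addC : commutative dsum_add.
Proof. by move=> x y; apply/ffunP => u; rewrite !ffunE addrC. Qed.
Lemma dsum_add0 : left_id dsum_zero dsum_add.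
Proof. by move=> x; apply/ffunP => u; rewrite !ffunE add0r. Qed.
Lemma dsum_addN : left_inverse dsum_zero dsum_opp dsum_add.
Proof. by move=> x; apply/ffunP => u; rewrite !ffunE addNr. Qed.
HB.instance Definition _ :=
  GRing.isZmodule.Build dsum_sort dsum_addA dsum_addC dsum_add0 dsum_addN.

Lemma dsum_scaleA p q x : dsum_scale p (dsum_scale q x) = dsum_scale (p * q) x.
Proof. by apply/ffunP => u; rewrite !ffunE scalerA. Qed.
Lemma dsum_scale1 : left_id 1 dsum_scale.
Proof. by move=> x; apply/ffunP => u; rewrite !ffunE scale1r. Qed.
Lemma dsum_scaleDr : right_distributive dsum_scale +%R.
Proof. by move=> p x y; apply/ffunP => u; rewrite !ffunE scalerDr. Qed.
Lemma dsum_scaleDl x : {morph dsum_scale^~ x : p q / p + q}.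
Proof. by move=> p q; apply/ffunP => u; rewrite !ffunE scalerDl. Qed.
HB.instance Definition _ := GRing.Zmodule_isLmodule.Build P dsum_sort
  dsum_scaleA dsum_scale1 dsum_scaleDr dsum_scaleDl.

Lemma dsumDE x y u : (x + y) u = x u + y u.
Proof. exact: ffunE. Qed.
Lemma dsumZE p x u : (p *: x) u = p *: x u.
Proof. exact: ffunE. Qed.
Lemma dsum0E u : (0 : dsum_sort) u = 0.
Proof. exact: ffunE. Qed.
Lemma dsum_sumE (I : Type) (s : seq I) (f : I -> dsum_sort) u :
  (\sum_(i <- s) f i) u = \sum_(i <- s) f i u.
Proof.
by elim: s => [|i s IH]; rewrite ?big_nil ?dsum0E // !big_cons dsumDE IH.
Qed.

End DirectSum.

(* The homogeneous components of a family of elements can be taken over a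
   common duplicate-free list of degrees. *)
Lemma gm_sum_on (M : grModule) (x : M) : exists (s : seq (zdeg n)),
  forall t, uniq t -> {subset s <= t} -> exists f : zdeg n -> M,
    (forall a, gm_hom a (f a)) /\ x = \sum_(a <- t) f a.
Proof.
have [s [f [fh ->]]] := gm_sum x; exists s => t ut st.
have [g [gh gE]] : exists g : zdeg n -> M,
    (forall a, gm_hom a (g a)) /\ forall a, g a = \sum_(b <- s | b == a) f b.
  exists (fun a => \sum_(b <- s | b == a) f b); split=> // a.
  by elim/big_ind: _ => [|y z|b /eqP <-] //; [exact: gm_hom0|exact: gm_homD].
exists g; split=> //; under [RHS]eq_bigr => a _ do rewrite gE.
rewrite (exchange_big_dep predT) //= big_seq [RHS]big_seq; apply: eq_bigr => b bs.
by rewrite (big_rem b) ?st //= eqxx big1_seq ?addr0 // => a /andP[/eqP <-];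
   rewrite mem_rem_uniqF.
Qed.

Section DirectSumGrading.
Variables (U : finType) (M : U -> grModule).
Implicit Types x y : dsum_sort M.

Definition dsum_hom (a : zdeg n) (x : dsum_sort M) : Prop :=
  forall u, gm_hom a (x u).

Lemma dsum_hom0 a : dsum_hom a 0.
Proof. by move=> u; rewrite dsum0E; apply: gm_hom0. Qed.

Lemma dsum_homD a x y : dsum_hom a x -> dsum_hom a y -> dsum_hom a (x + y).
Proof. by move=> xa ya u; rewrite dsumDE; apply: gm_homD. Qed.

Lemma dsum_homZ a b (p : P) x :
  mhomog b p -> dsum_hom a x -> dsum_hom (b + a) (p *: x).
Proof. by move=> pb xa u; rewrite dsumZE; apply: gm_homZ. Qed.

Lemma dsum_hom_sum x : exists (s : seq (zdeg n)) (f : zdeg n -> dsum_sort M),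
  (forall a, dsum_hom a (f a)) /\ x = \sum_(a <- s) f a.
Proof.
pose s u := proj1_sig (cid (gm_sum_on (x u))).
pose t := undup (flatten [seq s u | u <- enum U]).
have fu u : exists f : zdeg n -> M u,
    (forall a, gm_hom a (f a)) /\ x u = \sum_(a <- t) f a.
  apply: (proj2_sig (cid (gm_sum_on (x u)))) => [|a au]; first exact: undup_uniq.
  by rewrite mem_undup; apply/flatten_mapP; exists u; rewrite ?mem_enum.
pose f u := proj1_sig (cid (fu u)).
have fP u : (forall a, gm_hom a (f u a)) /\ x u = \sum_(a <- t) f u a :=
  proj2_sig (cid (fu u)).
exists t, (fun a => [ffun u => f u a]); split=> [a u|].
  by rewrite ffunE; apply: (fP u).1.
apply/ffunP => u; rewrite dsum_sumE (fP u).2.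
by apply: eq_bigr => a _; rewrite ffunE.
Qed.

Lemma dsum_hom_indep (s : seq (zdeg n)) (f : zdeg n -> dsum_sort M) :
  uniq s -> (forall a, dsum_hom a (f a)) -> \sum_(a <- s) f a = 0 ->
  forall a, a \in s -> f a = 0.
Proof.
move=> us fh s0 a sa; apply/ffunP => u; rewrite dsum0E.
apply: (gm_indep us (f := fun b => f b u)) sa => [b|]; first exact: fh.
by rewrite -dsum_sumE s0 dsum0E.
Qed.

Definition gm_dsum : grModule :=
  GrModule dsum_hom0 dsum_homD dsum_homZ dsum_hom_sum dsum_hom_indep.

End DirectSumGrading.

End GradedModules.

Section Resolutions.
Variables (K : fieldType) (n : nat).
Local Notation P := {mpoly K[n]}.

(* The k-th term of a complex of graded free modules of finite rank is the sum
   of the P(- fc_deg k i), i < fc_rk k.  Elements are row vectors and the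
   differential, from term k.+1 to term k, acts by right multiplication. *)
Record fcomplex := FComplex {
  fc_rk : nat -> nat;
  fc_deg : forall k, 'I_(fc_rk k) -> zdeg n;
  fc_d : forall k, 'M[P]_(fc_rk k.+1, fc_rk k) }.

Definition mx_homog (r s : nat) (b : 'I_r -> zdeg n) (c : 'I_s -> zdeg n)
    (A : 'M[P]_(r, s)) : Prop :=
  forall i j, mhomog (b i - c j) (A i j).

(* The linear map from the free module of rank r sending the i-th basis vector
   to g i. *)
Definition row_eval (M : grModule K n) (r : nat) (g : 'I_r -> M) (x : 'rV[P]_r)
  : M := \sum_i x 0 i *: g i.

(* The augmentation of the complex C is given by the images g i of the basis
   vectors of its 0-th term; B is a submodule of M. *)
Definition resolves_sub (M : grModule K n) (B : M -> Prop) (C : fcomplex)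
    (g : 'I_(fc_rk C 0) -> M) : Prop :=
  [/\ forall k, mx_homog (@fc_deg C k.+1) (@fc_deg C k) (fc_d C k),
      forall i, gm_hom (fc_deg i) (g i),
      forall y, B y <-> exists x, y = row_eval g x,
      forall x, row_eval g x = 0 <-> exists y, x = y *m fc_d C 0
    & forall k (x : 'rV[P]_(fc_rk C k.+1)),
        x *m fc_d C k = 0 <-> exists y, x = y *m fc_d C k.+1].

Definition free_resolution (M : grModule K n) := resolves_sub (fun _ : M => True).

(* The differentials map into the multiples of the ideal of the variables. *)
Definition minimal_complex (C : fcomplex) : Prop :=
  forall k i j, (fc_d C k i j)@_0%MM = 0.

Definition minimal_free_resolution (M : grModule K n) (C : fcomplex)
    (g : 'I_(fc_rk C 0) -> M) : Prop :=
  free_resolution g /\ minimal_complex C.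

(* The differential of the complex C (x) K of K-vector spaces, where K is P
   modulo the ideal of the variables. *)
Definition fc_dK (C : fcomplex) (k : nat) : 'M[K]_(fc_rk C k.+1, fc_rk C k) :=
  map_mx (mcoeff 0%MM) (fc_d C k).

(* Subspaces of the k-th term of C (x) K are given as row spaces: the component
   of degree a, and the cycles. *)
Definition fc_comp (C : fcomplex) (k : nat) (a : zdeg n) : 'M[K]_(fc_rk C k) :=
  diag_mx (\row_i (@fc_deg C k i == a)%:R).

Definition fc_cycles (C : fcomplex) (k : nat) : 'M[K]_(fc_rk C k) :=
  match k with 0 => 1%:M | k'.+1 => kermx (fc_dK C k') end.

(* dim_K [H_k(C (x) K)]_a *)
Definition hdim (C : fcomplex) (k : nat) (a : zdeg n) : nat :=
  (\rank (fc_cycles C k :&: fc_comp C k a)%MS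
   - \rank (fc_dK C k :&: fc_comp C k a)%MS)%N.

Definition zero_complex : fcomplex :=
  @FComplex (fun _ => 0%N) (fun _ _ => 0) (fun _ => 0).

(* dim_K [Tor_k(M, K)]_a, computed from some free resolution of M.  Every
   finitely generated M has one, with terms of finite rank, and hdim does not
   depend on it. *)
Definition betti (M : grModule K n) (k : int) (a : zdeg n) : nat :=
  match k with
  | Posz k => hdim (epsilon (inhabits zero_complex)
                     (fun C => exists g, @free_resolution M C g)) k a
  | Negz _ => 0%N
  end.

(* Comparison maps lifting the inclusion of a submodule B of M, where C resolves
   B with augmentation g and D resolves M with augmentation h. *)
Definition comparison (M : grModule K n) (C D : fcomplex)
    (g : 'I_(fc_rk C 0) -> M) (h : 'I_(fc_rk D 0) -> M)
    (f : forall k, 'M[P]_(fc_rk C k, fc_rk D k)) : Prop :=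
  [/\ forall k, mx_homog (@fc_deg C k) (@fc_deg D k) (f k),
      forall x, row_eval h (x *m f 0) = row_eval g x
    & forall k, fc_d C k *m f k = f k.+1 *m fc_d D k].

(* The mapping cone of f : C -> D, with k.+1-st term C_k (+) D_(k.+1) and
   differential (x, y) |-> (- dx, f x + dy). *)
Section Cone.
Variables (C D : fcomplex) (f : forall k, 'M[P]_(fc_rk C k, fc_rk D k)).

Definition cone_rk (k : nat) : nat :=
  match k with 0 => fc_rk D 0 | k'.+1 => (fc_rk C k' + fc_rk D k'.+1)%N end.

Definition cone_deg (k : nat) : 'I_(cone_rk k) -> zdeg n :=
  match k with
  | 0 => @fc_deg D 0
  | k'.+1 => fun i => match split i with
                      | inl i1 => @fc_deg C k' i1
                      | inr i2 => @fc_deg D k'.+1 i2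
                      end
  end.

Definition cone_d (k : nat) : 'M[P]_(cone_rk k.+1, cone_rk k) :=
  match k with
  | 0 => col_mx (f 0) (fc_d D 0)
  | k'.+1 => block_mx (- fc_d C k') (f k'.+1) 0 (fc_d D k'.+1)
  end.

Definition cone : fcomplex := FComplex cone_deg cone_d.

End Cone.

(* Let 0 -> E d.+1 -> ... -> E 1 -> E 0 -> 0 be exact with maps phi, and let
   G k, with augmentation gam k, resolve E k.+1 for k <= d.  The sequence breaks
   into 0 -> im (phi k.+1) -> E k.+1 -> im (phi k) -> 0.  The predicate
   iterated_cone E phi G gam d k C g says that C, augmented by g : C_0 -> E k,
   is obtained from these sequences as a resolution of im (phi k): it is G d for
   k = d, and for k < d the cone of a comparison map from a complex so obtained
   for im (phi k.+1) to G k.  For k = 0 the resolved module is E 0. *)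
Inductive iterated_cone (E : nat -> grModule K n)
    (phi : forall k, {linear E k.+1 -> E k})
    (G : nat -> fcomplex) (gam : forall k, 'I_(fc_rk (G k) 0) -> E k.+1)
    (d : nat) : forall (k : nat) (C : fcomplex), ('I_(fc_rk C 0) -> E k) -> Prop :=
| iterated_cone_top :
    @iterated_cone E phi G gam d d (G d) (fun i => phi d (gam d i))
| iterated_cone_step k C (g : 'I_(fc_rk C 0) -> E k.+1) f :
    (k < d)%N -> @iterated_cone E phi G gam d k.+1 C g ->
    comparison g (gam k) f ->
    @iterated_cone E phi G gam d k (@cone C (G k) f) (fun i => phi k (gam k i)).

End Resolutions.

Section Colored.
Variables (K : fieldType) (d : nat) (m : 'I_d -> nat).

(* The variable x_(i,j) has index tagnat.Rank i j; indices start at 0. *)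
Definition nvars := (\sum_i m i)%N.
Local Notation P := {mpoly K[nvars]}.

Definition var (i : 'I_d) (j : 'I_(m i)) : 'I_nvars := @tagnat.Rank d m i j.
Definition color (v : 'I_nvars) : 'I_d := @tagnat.sig1 d m v.

Definition sqfree (u : 'X_{1..nvars}) : bool := [forall v, (u v <= 1)%N].

Definition color_sqfree (u : 'X_{1..nvars}) : bool :=
  sqfree u &&
  [forall v, forall w, [&& 0 < u v, 0 < u w & color v == color w]%N ==> (v == w)].

Definition color_sqfree_ideal (I : monIdeal K nvars) : Prop :=
  forall u, min_generator I u -> color_sqfree u.

Definition m_ (i : 'I_d) : monIdeal K nvars :=
  mi_of K (fun u => exists j, u = U_(@var i j)%MM).

Definition m_br2 (i : 'I_d) : monIdeal K nvars :=
  mi_of K (fun u => exists j k : 'I_(m i),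
    (j < k)%N /\ u = (U_(var j) + U_(var k))%MM).

Definition m_sq (i : 'I_d) : monIdeal K nvars := mi_mul (m_ i) (m_ i).

Definition add_br2 (I : monIdeal K nvars) : monIdeal K nvars :=
  \big[@mi_add K nvars/I]_(i < d) m_br2 i.

Definition add_sq (I : monIdeal K nvars) : monIdeal K nvars :=
  \big[@mi_add K nvars/I]_(i < d) m_sq i.

Definition mon_of_deg (Q : pred 'X_{1..nvars}) (k : nat) :=
  {u : 'X_{1..nvars < k.+1} | Q u && (mdeg u == k)}.

Definition mon_val Q k (u : mon_of_deg Q k) : 'X_{1..nvars} := val (val u).
Coercion mon_val : mon_of_deg >-> multinom.

Lemma color_sqfree_sub k (u : mon_of_deg color_sqfree k) :
  sqfree (val u) && (mdeg (val u) == k).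
Proof. by case/andP: (valP u) => /andP[-> _] ->. Qed.

Definition sqfree_of k (u : mon_of_deg color_sqfree k) : mon_of_deg sqfree k :=
  exist _ (val u) (color_sqfree_sub u).

Definition F_summand (I : monIdeal K nvars) (u : 'X_{1..nvars}) :
    grModule K nvars :=
  gm_shift (gm_quot (mi_colon I u)) (- (deg_mon u *+ 2)).

Definition F_ (I : monIdeal K nvars) (k : nat) : grModule K nvars :=
  gm_dsum (fun u : mon_of_deg color_sqfree k => F_summand I u).

(* The k-th term of the Koszul complex of the squares of the variables, and its
   differential e_u |-> sum over x | u of (-1)^#{y | u, y < x} x^2 e_(u/x) *)
Definition koszul (k : nat) := {ffun mon_of_deg sqfree k -> P}.

Definition koszul_sign (u : 'X_{1..nvars}) (v : 'I_nvars) : P :=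
  (-1) ^+ (\sum_(w < nvars | (w < v)%N) u w).

Definition koszul_d (k : nat) (z : koszul k.+1) : koszul k :=
  [ffun w : mon_of_deg sqfree k =>
    \sum_(u : mon_of_deg sqfree k.+1)
      \sum_(v : 'I_nvars | (u : 'X_{1..nvars}) == (w + U_(v))%MM)
        z u * koszul_sign u v * 'X_v ^+ 2].

(* The projection of the Koszul complex onto the quotients P/(I:u), which vanish
   for u not color-squarefree when I contains the ideals m_i^[2]. *)
Definition koszul_proj (I : monIdeal K nvars) (k : nat) (z : koszul k) : F_ I k :=
  [ffun u : mon_of_deg color_sqfree k =>
     mclass (mi_colon I u) (z (sqfree_of u)) : F_summand I u].

Definition F_seq (I : monIdeal K nvars) (M : grModule K nvars) (k : nat) :
    grModule K nvars :=
  match k with 0 => M | k'.+1 => F_ I k' end.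

End Colored.

(* Main.v *)
Require Import Defs.
From HB Require Import structures.
From Stdlib Require Import ClassicalEpsilon.
From mathcomp Require Import all_boot all_order all_algebra.
From mathcomp Require Import boolp zify ring.
From mathcomp Require Import mpoly.

Set Implicit Arguments.
Unset Strict Implicit.
Unset Printing Implicit Defensive.

Import GRing.Theory.

Local Open Scope ring_scope.

(** Everything happens one fine degree at a time.

    Exactness.  The ideal [I'] is a squarefree monomial ideal, so whether a
    monomial lies in it depends only on its support.  For an exponent vector [a]
    the summand of the [k]-th term indexed by [u] is nonzero in degree [a] iff
    [2 deg u <= a] and [x^(a - deg u)] is not in [I']; as [a - deg u] and [a]
    have the same support, the second condition says that [x^a] is not in [I']
    and does not involve [u].  Hence in degree [a] the sequence is either zero or
    the augmented chain complex of the full simplex on the variables of exponent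
    at least two in [a], which is contracted onto any of its vertices
    ([bd_contract]).  If there is no such variable the sequence reduces to
    [P/I' -> P/(I + sum m_i^2)], an isomorphism in that degree.  This gives
    [Fd_exact] and [Faug_exact].

    Minimality.  For squarefree [u] the ideal [I':u] is squarefree and does not
    involve the variables of [u]: multiplication by a variable [v] is bijective
    on [P/(I':u)] in all degrees with [v]-coordinate at least one, and even at
    least zero when [v] divides [u].  This property passes to kernels of maps of
    free modules whose degrees are squarefree and prime to [u], so [P/(I':u)] has
    a minimal resolution with all degrees of this kind
    ([minimal_resolution_exists]).  After the shift by [2 deg u], every degree in
    a minimal resolution of the [k]-th term has exactly [k] coordinates equal to
    two ([F_resolution_weight]).  The complex obtained from the terms of index
    above [k] therefore shares no degree with the resolution of the [k]-th term,
    and a comparison map between them, being homogeneous of degree zero, has no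
    unit entries: the cone is again minimal ([iterated_cone_minimal]).

    Betti numbers.  The [Tor]-dimensions do not depend on the resolution
    ([hdim_indep]), and for a minimal one they count its basis vectors.  The basis
    vectors of an iterated cone are those of the resolutions it is made of, with
    homological degrees shifted ([ncells_iterated_cone]), and choosing for each
    term the direct sum of shifted resolutions of the [P/(I':u)] gives the
    formula. *)

(** * Homogeneous components of polynomials *)

Lemma sum_seq_single (V : nmodType) (I : eqType) (s : seq I) w (F : I -> V) :
  uniq s -> (forall i, i != w -> F i = 0) ->
  \sum_(i <- s) F i = if w \in s then F w else 0.
Proof.
move=> us F0; case: ifP => [ws|ws].
  by rewrite (bigD1_seq w) //= big1 ?addr0.
rewrite big_seq big1 // => i is_; apply: F0; apply: contraFN ws => /eqP <- //.
Qed.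

Section HomogeneousComponents.
Variables (K : fieldType) (n : nat).
Local Notation P := {mpoly K[n]}.
Implicit Types (p q : P) (a b : zdeg n).

(** In the fine grading each graded piece of [P] is at most one-dimensional, so
    the sum has at most one nonzero term. *)
Definition hcomp a p : P :=
  \sum_(u <- msupp p | deg_mon u == a) p@_u *: 'X_[u].

Lemma mcoeff_hcomp a p w : (hcomp a p)@_w = if deg_mon w == a then p@_w else 0.
Proof.
rewrite /hcomp raddf_sum big_mkcond /= (@sum_seq_single _ _ _ w) ?msupp_uniq //.
  rewrite mcoeffZ mcoeffX eqxx mulr1; case: ifP => // wp.
  by case: ifP => // _; rewrite memN_msupp_eq0 ?wp.
by move=> u uw; case: ifP => // _; rewrite mcoeffZ mcoeffX (negPf uw) mulr0.
Qed.

Lemma hcompD a : {morph hcomp a : p q / p + q}.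
Proof.
move=> p q; apply/mpolyP => w; rewrite mcoeffD !mcoeff_hcomp mcoeffD.
by case: ifP => // _; rewrite addr0.
Qed.

Lemma hcomp0 a : hcomp a 0 = 0.
Proof. by rewrite /hcomp msupp0 big_nil. Qed.

Lemma hcomp_sum a I (r : seq I) (F : I -> P) :
  hcomp a (\sum_(i <- r) F i) = \sum_(i <- r) hcomp a (F i).
Proof. exact: (big_morph _ (hcompD a) (hcomp0 a)). Qed.

Lemma hcomp_homog a p : mhomog a (hcomp a p).
Proof.
by move=> u; rewrite mcoeff_msupp mcoeff_hcomp; case: ifP => [/eqP|]; rewrite ?eqxx.
Qed.

Lemma hcomp_id a p : mhomog a p -> hcomp a p = p.
Proof.
move=> pa; apply/mpolyP => w; rewrite mcoeff_hcomp; case: ifP => // wa.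
by apply/esym/eqP; apply: contraFT wa => pw; rewrite pa ?mcoeff_msupp ?eqxx.
Qed.

Lemma mhomogZ a c p : mhomog a p -> mhomog a (c *: p).
Proof. by move=> pa u /msuppZ_le /pa. Qed.

Lemma mhomogN a p : mhomog a p -> mhomog a (- p).
Proof. by move=> pa; rewrite -scaleN1r; apply: mhomogZ. Qed.

Lemma mhomogB a p q : mhomog a p -> mhomog a q -> mhomog a (p - q).
Proof. by move=> pa qa; apply: mhomogD => //; apply: mhomogN. Qed.

Lemma mhomog_sum a (I : Type) (r : seq I) (F : I -> P) :
  (forall i, mhomog a (F i)) -> mhomog a (\sum_(i <- r) F i).
Proof.
move=> Fa; elim/big_rec: _ => [|i p _]; first exact: mhomog0.
exact: mhomogD.
Qed.

Lemma deg_mon0 : deg_mon (0%MM : 'X_{1..n}) = 0.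
Proof. by apply/ffunP => v; rewrite !ffunE mnm0E. Qed.

Lemma mhomog1 : mhomog 0 (1 : P).
Proof. by move=> u; rewrite msupp1 inE => /eqP ->; rewrite deg_mon0. Qed.

Lemma mhomogX (u : 'X_{1..n}) : mhomog (deg_mon u) ('X_[u] : P).
Proof. by move=> w; rewrite msuppX inE => /eqP ->. Qed.

Lemma hcompM a b p q : mhomog b q -> hcomp (a + b) (p * q) = hcomp a p * q.
Proof.
move=> qb; have [->|[u qu]] : q = 0 \/ exists u, q@_u != 0.
- have [->|/eqP q0] := eqVneq q 0; [by left|right].
  by apply/not_existsP => H; apply: q0; apply/mpolyP => u; rewrite mcoeff0;
     have /negP/negPn/eqP := H u.
- by rewrite !mulr0 hcomp0.
have [<- ->] := mhomog_coef qb qu.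
rewrite -!scalerAr; apply/mpolyP => w; rewrite mcoeff_hcomp !mcoeffZ.
have [uw|uw] := boolP (u <= w)%MM.
  have -> : w = (u + (w - u))%MM by rewrite addmC submK.
  rewrite !mcoeffMX mcoeff_hcomp deg_monD addrC (inj_eq (addIr _)).
  by case: ifP => // _; rewrite mulr0.
have X0 r : (r * 'X_[u])@_w = 0.
  apply: memN_msupp_eq0; rewrite (perm_mem (msuppMX _ _)).
  by apply: contra uw => /mapP[v _ ->]; apply: lem_addr.
by rewrite !X0 mulr0 if_same.
Qed.

Lemma hcomp_decomp p (s : seq (zdeg n)) :
    uniq s -> (forall u, u \in msupp p -> deg_mon u \in s) ->
  p = \sum_(a <- s) hcomp a p.
Proof.
move=> us ps; apply/mpolyP => w; rewrite raddf_sum /=.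
rewrite (@sum_seq_single _ _ _ (deg_mon w)) //.
  rewrite mcoeff_hcomp eqxx; case: ifPn => // ws.
  by apply: memN_msupp_eq0; apply: contra ws => /ps.
by move=> a aw; rewrite mcoeff_hcomp eq_sym (negPf aw).
Qed.

Lemma mhomog_coef0 a p : mhomog a p -> p@_0 != 0 -> a = 0.
Proof. by move=> pa /(mhomog_coef pa)[<- _]; rewrite deg_mon0. Qed.

End HomogeneousComponents.

(** * Lifting homogeneous maps between free modules *)

Section HomogeneousMatrices.
Variables (K : fieldType) (n : nat).
Local Notation P := {mpoly K[n]}.

(** The component of degree [a] of an element of the free module whose basis
    vectors have the degrees [c]. *)
Definition row_hcomp r (c : 'I_r -> zdeg n) a (x : 'rV[P]_r) : 'rV[P]_r :=
  \row_j hcomp (a - c j) (x 0 j).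

Definition row_homog r (c : 'I_r -> zdeg n) a (x : 'rV[P]_r) : Prop :=
  forall j, mhomog (a - c j) (x 0 j).

Lemma row_hcomp_homog r (c : 'I_r -> zdeg n) a x : row_homog c a (row_hcomp c a x).
Proof. by move=> j; rewrite mxE; apply: hcomp_homog. Qed.

Lemma row_hcomp_id r (c : 'I_r -> zdeg n) a x :
  row_homog c a x -> row_hcomp c a x = x.
Proof. by move=> xa; apply/rowP => j; rewrite mxE hcomp_id. Qed.

Lemma row_hcomp_decomp r (c : 'I_r -> zdeg n) (x : 'rV[P]_r) (l : seq (zdeg n)) :
  exists s, [/\ uniq s, {subset l <= s} & x = \sum_(e <- s) row_hcomp c e x].
Proof.
pose t := flatten [seq [seq deg_mon u + c j | u <- msupp (x 0 j)] | j : 'I_r].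
have us : uniq (undup (l ++ t)) by apply: undup_uniq.
exists (undup (l ++ t)); split=> // [e el|].
  by rewrite mem_undup mem_cat el.
apply/rowP => j; rewrite summxE.
rewrite {1}(@hcomp_decomp _ _ (x 0 j) [seq e - c j | e <- undup (l ++ t)]).
- by rewrite big_map; apply: eq_bigr => e _; rewrite mxE.
- by rewrite map_inj_uniq //; apply: addIr.
move=> u ux; rewrite -[deg_mon u](addrK (c j)); apply: map_f.
rewrite mem_undup mem_cat; apply/orP; right; apply/flatten_mapP; exists j.
  by rewrite mem_enum.
by apply/mapP; exists u.
Qed.

Lemma row_hcompM r s (b : 'I_r -> zdeg n) (c : 'I_s -> zdeg n) (A : 'M[P]_(r, s)) a x :
  mx_homog b c A -> row_hcomp c a (x *m A) = row_hcomp b a x *m A.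
Proof.
move=> Ah; apply/rowP => j; rewrite !mxE hcomp_sum; apply: eq_bigr => i _.
by rewrite mxE -(hcompM _ _ (Ah i j)) addrA subrK.
Qed.

Lemma row_homogM r s (b : 'I_r -> zdeg n) (c : 'I_s -> zdeg n) (A : 'M[P]_(r, s)) a x :
  mx_homog b c A -> row_homog b a x -> row_homog c a (x *m A).
Proof.
move=> Ah xa; rewrite -(row_hcomp_id xa) -(row_hcompM _ _ Ah).
exact: row_hcomp_homog.
Qed.

Lemma mx_homogP r s (b : 'I_r -> zdeg n) (c : 'I_s -> zdeg n) (A : 'M[P]_(r, s)) :
  mx_homog b c A <-> forall i, row_homog c (b i) (row i A).
Proof.
split=> H i j; first by rewrite mxE; apply: H.
by have := H i j; rewrite mxE.
Qed.

Lemma mx_homogM r s t (b : 'I_r -> zdeg n) (c : 'I_s -> zdeg n)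
    (e : 'I_t -> zdeg n) (A : 'M[P]_(r, s)) (B : 'M[P]_(s, t)) :
  mx_homog b c A -> mx_homog c e B -> mx_homog b e (A *m B).
Proof.
move=> /mx_homogP Ah Bh; apply/mx_homogP => i; rewrite row_mul.
exact: row_homogM Bh (Ah i).
Qed.

Lemma mx_homogD r s (b : 'I_r -> zdeg n) (c : 'I_s -> zdeg n) (A B : 'M[P]_(r, s)) :
  mx_homog b c A -> mx_homog b c B -> mx_homog b c (A + B).
Proof. by move=> Ah Bh i j; rewrite mxE; apply: mhomogD. Qed.

Lemma mx_homogN r s (b : 'I_r -> zdeg n) (c : 'I_s -> zdeg n) (A : 'M[P]_(r, s)) :
  mx_homog b c A -> mx_homog b c (- A).
Proof. by move=> Ah i j; rewrite mxE; apply: mhomogN. Qed.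

Lemma mx_homog1 r (b : 'I_r -> zdeg n) : mx_homog b b (1%:M : 'M[P]_r).
Proof.
move=> i j; rewrite mxE; case: eqP => [->|_]; last exact: mhomog0.
by rewrite subrr; apply: mhomog1.
Qed.

(** Solutions of a homogeneous linear system can be made homogeneous by taking
    components of the right degrees. *)
Lemma mx_lift r s t (b : 'I_r -> zdeg n) (c : 'I_s -> zdeg n)
    (e : 'I_t -> zdeg n) (A : 'M[P]_(r, s)) (B : 'M[P]_(t, s)) :
    mx_homog b c A -> mx_homog e c B ->
    (forall i, exists y, row i A = y *m B) ->
  exists2 X, mx_homog b e X & A = X *m B.
Proof.
move=> /mx_homogP Ah Bh /choice[y yA].
exists (\matrix_i row_hcomp e (b i) (y i)).
  by apply/mx_homogP => i; rewrite rowK; apply: row_hcomp_homog.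
apply/row_matrixP => i; rewrite row_mul rowK -(row_hcompM _ _ Bh) -yA.
by rewrite row_hcomp_id.
Qed.

Section RowEval.
Variables (M : grModule K n) (r : nat) (g : 'I_r -> M).

Lemma row_eval_is_linear : linear (row_eval g).
Proof.
move=> p x y; rewrite /row_eval scaler_sumr -big_split; apply: eq_bigr => i _.
by rewrite !mxE scalerDl scalerA.
Qed.
HB.instance Definition _ :=
  GRing.isLinear.Build P 'rV[P]_r M *:%R (row_eval g) row_eval_is_linear.

Lemma row_eval_delta i : row_eval g (delta_mx 0 i) = g i.
Proof.
rewrite /row_eval (bigD1 i) //= mxE !eqxx scale1r big1 ?addr0 // => j ji.
by rewrite mxE (negPf ji) andbF scale0r.
Qed.

Lemma row_eval_mul s (A : 'M[P]_(s, r)) x :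
  row_eval g (x *m A) = row_eval (fun i => row_eval g (row i A)) x.
Proof.
rewrite /row_eval; under [RHS]eq_bigr => i _ do rewrite scaler_sumr.
rewrite exchange_big; apply: eq_bigr => j _; rewrite mxE scaler_suml.
by apply: eq_bigr => i _; rewrite mxE scalerA.
Qed.

Lemma row_eval_hom (c : 'I_r -> zdeg n) a x :
    (forall i, gm_hom (c i) (g i)) -> row_homog c a x ->
  gm_hom a (row_eval g x).
Proof.
move=> gh xa; apply: (big_ind (gm_hom a)); first exact: gm_hom0.
  exact: gm_homD.
by move=> i _; rewrite -[a](subrK (c i)); apply: gm_homZ.
Qed.

(** Lifting through a homogeneous surjection preserves degrees: the component
    of degree [a] of a preimage is again a preimage, since the components of an
    element of [M] are determined by it. *)
Lemma row_eval_hcomp (c : 'I_r -> zdeg n) a x y :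
    (forall i, gm_hom (c i) (g i)) -> gm_hom a y -> y = row_eval g x ->
  y = row_eval g (row_hcomp c a x).
Proof.
move=> gh ya yx.
have [s [us ss xs]] := row_hcomp_decomp c x [:: a].
have as_ : a \in s by apply: ss; rewrite mem_head.
(* [y] has [y] itself as its only component. *)
pose f e := row_eval g (row_hcomp c e x) - (if e == a then y else 0).
have f0 : \sum_(e <- s) f e = 0.
  rewrite sumrB (@sum_seq_single _ _ _ a (fun e => if e == a then y else 0)) //.
    by rewrite as_ eqxx -raddf_sum -xs yx subrr.
  by move=> e /negPf ->.
have fh e : gm_hom e (f e).
  apply: gm_homD; first by apply: row_eval_hom => //; apply: row_hcomp_homog.
  case: eqP => [->|_]; last by rewrite oppr0; apply: gm_hom0.
  rewrite -scaleN1r -[a]add0r; apply: gm_homZ => //.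
  by apply: mhomogN; apply: mhomog1.
by have /eqP := gm_indep us fh f0 as_; rewrite /f eqxx subr_eq0 => /eqP.
Qed.

End RowEval.
End HomogeneousMatrices.

(** * Comparison maps and homotopies *)

(** Comparison maps and homotopies are sequences of matrices, each chosen in
    terms of the previous one, whose sizes vary with the homological degree. *)
Lemma dependent_choice (T : nat -> Type) (Inv : forall k, T k -> Prop)
    (R : forall k, T k -> T k.+1 -> Prop) :
    (exists x, Inv 0 x) ->
    (forall k x, Inv k x -> exists2 y, R k x y & Inv k.+1 y) ->
  exists f : forall k, T k, (forall k, Inv k (f k)) /\ forall k, R k (f k) (f k.+1).
Proof.
move=> /cid[x0 I0] step.
have next k (x : {x | Inv k x}) : {y : {y | Inv k.+1 y} | R k (sval x) (sval y)}.
  by have [y Rxy Iy] := cid2 (step k _ (svalP x)); exists (exist _ y Iy).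
pose F := fix F k : {x | Inv k x} :=
  match k with 0 => exist _ x0 I0 | k'.+1 => sval (next k' (F k')) end.
exists (fun k => sval (F k)); split=> k; first exact: (svalP (F k)).
exact: (svalP (next k (F k))).
Qed.

Section Comparison.
Variables (K : fieldType) (n : nat).
Local Notation P := {mpoly K[n]}.
Local Notation fcomplex := (fcomplex K n).
Implicit Types (C D : fcomplex) (M N : grModule K n).

Section Resolves.
Variables (M : grModule K n) (B : M -> Prop) (C : fcomplex).
Variables (g : 'I_(fc_rk C 0) -> M).
Hypothesis CB : resolves_sub B g.

Lemma res_d_homog k : mx_homog (@fc_deg _ _ C k.+1) (@fc_deg _ _ C k) (fc_d C k).
Proof. by case: CB. Qed.

Lemma res_aug_homog i : gm_hom (fc_deg i) (g i).
Proof. by case: CB. Qed.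

Lemma res_mem x : B (row_eval g x).
Proof. by case: CB => _ _ H _ _; apply/H; exists x. Qed.

Lemma res_surj y : B y -> exists x, y = row_eval g x.
Proof. by case: CB => _ _ H _ _ /H. Qed.

Lemma res_aug_ker x : row_eval g x = 0 -> exists y, x = y *m fc_d C 0.
Proof. by case: CB => _ _ _ H _ /H. Qed.

Lemma res_d_ker k (x : 'rV_(fc_rk C k.+1)) :
  x *m fc_d C k = 0 -> exists y, x = y *m fc_d C k.+1.
Proof. by case: CB => _ _ _ _ H /H. Qed.

Lemma res_aug_d x : row_eval g (x *m fc_d C 0) = 0.
Proof. by case: CB => _ _ _ H _; apply/H; exists x. Qed.

Lemma res_dd k : fc_d C k.+1 *m fc_d C k = 0.
Proof.
case: CB => _ _ _ _ H; apply/row_matrixP => i; rewrite row0 row_mul.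
by apply/H; exists (delta_mx 0 i); rewrite rowE.
Qed.

End Resolves.
Arguments res_d_homog {M B C g} CB k.
Arguments res_dd {M B C g} CB k.
Arguments res_aug_homog {M B C g} CB i.

(** The invariant of the induction is that [f k] maps boundaries of [C] to
    cycles of [D], which are boundaries. *)
Lemma comparison_exists M (B B' : M -> Prop) C D g h :
    @resolves_sub K n M B C g -> @resolves_sub K n M B' D h ->
    (forall x, B x -> B' x) ->
  exists f, comparison g h f.
Proof.
move=> CB DB BB.
pose T k := 'M[P]_(fc_rk C k, fc_rk D k).
pose hom k (f : T k) := mx_homog (@fc_deg _ _ C k) (@fc_deg _ _ D k) f.
pose Inv k : T k -> Prop :=
  match k with
  | 0 => fun f => hom 0 f /\ forall x, row_eval h (x *m f) = row_eval g x
  | k'.+1 => fun f => hom k'.+1 f /\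
       exists2 f' : T k', hom k' f' & fc_d C k' *m f' = f *m fc_d D k'
  end.
pose R k (f : T k) (f' : T k.+1) := hom k f /\ fc_d C k *m f = f' *m fc_d D k.
have [|k f If|f [fI fR]] := @dependent_choice T Inv R.
- have /choice[y yP] : forall i, exists y : 'rV_(fc_rk D 0), g i = row_eval h y.
    move=> i; apply: (res_surj DB); apply: BB.
    by rewrite -(row_eval_delta g); apply: (res_mem CB).
  exists (\matrix_i row_hcomp (@fc_deg _ _ D 0) (fc_deg i) (y i)); split.
    by apply/mx_homogP => i; rewrite rowK; apply: row_hcomp_homog.
  move=> x; rewrite row_eval_mul; apply: eq_bigr => i _; rewrite rowK; congr (_ *: _).
  apply/esym; apply: row_eval_hcomp (yP i); last exact: (res_aug_homog CB).
  exact: (res_aug_homog DB).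
- have hf : hom k f by case: k f If => [|k] f [].
  have im (x : 'rV_(fc_rk C k.+1)) : exists y, x *m (fc_d C k *m f) = y *m fc_d D k.
    case: k f If {hf} x => [|k] f [_ If] x.
      by apply: (res_aug_ker DB); rewrite mulmxA If; apply: (res_aug_d CB).
    apply: (res_d_ker DB); have [f' _ E] := If.
    by rewrite -!mulmxA -E [fc_d C k.+1 *m _]mulmxA (res_dd CB) mul0mx mulmx0.
  have [i|f' hf' E] := mx_lift (mx_homogM (res_d_homog CB k) hf) (res_d_homog DB k).
    by rewrite rowE; apply: im.
  by exists f' => //; split=> //; exists f.
have [_ f0] := fI 0%N.
exists f; split=> // k; first by case: (fR k).
by case: (fR k).
Qed.

(** The part of [f k.+1] not yet accounted for by [s k] consists of cycles of
    [D], hence of boundaries, through which it lifts. *)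
Lemma homotopy_exists M (B B' : M -> Prop) C D g h
    (f : forall k, 'M[P]_(fc_rk C k, fc_rk D k)) :
    @resolves_sub K n M B C g -> @resolves_sub K n M B' D h ->
    (forall k, mx_homog (@fc_deg _ _ C k) (@fc_deg _ _ D k) (f k)) ->
    (forall x, row_eval h (x *m f 0) = 0) ->
    (forall k, fc_d C k *m f k = f k.+1 *m fc_d D k) ->
  exists s : forall k, 'M[P]_(fc_rk C k, fc_rk D k.+1),
    [/\ forall k, mx_homog (@fc_deg _ _ C k) (@fc_deg _ _ D k.+1) (s k),
        f 0 = s 0 *m fc_d D 0
      & forall k, f k.+1 = fc_d C k *m s k + s k.+1 *m fc_d D k.+1].
Proof.
move=> CB DB fh f0 fd.
pose T k := 'M[P]_(fc_rk C k, fc_rk D k.+1).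
pose hom k (s : T k) := mx_homog (@fc_deg _ _ C k) (@fc_deg _ _ D k.+1) s.
pose cyc k (s : T k) := (f k.+1 - fc_d C k *m s) *m fc_d D k = 0.
pose Inv k : T k -> Prop :=
  match k with
  | 0 => fun s => [/\ hom 0 s, cyc 0 s & f 0 = s *m fc_d D 0]
  | k'.+1 => fun s => hom k'.+1 s /\ cyc k'.+1 s
  end.
pose R k (s : T k) (s' : T k.+1) :=
  hom k s /\ f k.+1 = fc_d C k *m s + s' *m fc_d D k.+1.
have [|k s Is|s [sI sR]] := @dependent_choice T Inv R.
- have [i|s sh E] := mx_lift (fh 0) (res_d_homog DB 0).
    by apply: (res_aug_ker DB); rewrite rowE f0.
  by exists s; split=> //; rewrite /cyc mulmxBl -fd E mulmxA subrr.
- have [hs cs] : hom k s /\ cyc k s by case: k s Is => [|k] s [].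
  have [||s' sh' E] := @mx_lift _ _ _ _ _ (@fc_deg _ _ C k.+1) (@fc_deg _ _ D k.+1)
    (@fc_deg _ _ D k.+2) (f k.+1 - fc_d C k *m s) _ _ (res_d_homog DB k.+1).
  + apply: mx_homogD; first exact: fh.
    by apply/mx_homogN/mx_homogM/hs/(res_d_homog CB).
  + by move=> i; apply: (res_d_ker DB); rewrite -row_mul cs row0.
  exists s'; first by split=> //; rewrite -E addrC subrK.
  split=> //; rewrite /cyc mulmxBl -fd -mulmxA -E mulmxBr [X in _ - (_ - X)]mulmxA.
  by rewrite (res_dd CB) mul0mx subr0 subrr.
have [_ _ s0] := sI 0%N.
exists s; split=> // k; by case: (sR k).
Qed.

End Comparison.

(** * Independence of Betti numbers from the resolution *)

Section Homology.
Variables (K : fieldType) (n : nat).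
Local Notation P := {mpoly K[n]}.
Local Notation fcomplex := (fcomplex K n).
Implicit Types (C D : fcomplex) (M N : grModule K n).

Definition mxK r s (A : 'M[P]_(r, s)) : 'M[K]_(r, s) := map_mx (mcoeff 0%MM) A.

Lemma mxKM r s t (A : 'M[P]_(r, s)) (B : 'M[P]_(s, t)) :
  mxK (A *m B) = mxK A *m mxK B.
Proof. exact: map_mxM. Qed.

Lemma mxKD r s (A B : 'M[P]_(r, s)) : mxK (A + B) = mxK A + mxK B.
Proof. exact: map_mxD. Qed.

Lemma mxK1 r : mxK (1%:M : 'M[P]_r) = 1%:M.
Proof. exact: map_mx1. Qed.

(** The projection onto the component of degree [a]. *)
Definition degsel r (b : 'I_r -> zdeg n) a : 'M[K]_r :=
  diag_mx (\row_i (b i == a)%:R).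

(** Homogeneous matrices of degree zero only connect basis vectors of equal
    degrees once the variables are set to zero. *)
Lemma degsel_mxK r s (b : 'I_r -> zdeg n) (c : 'I_s -> zdeg n) A a :
  mx_homog b c A -> degsel b a *m mxK A = mxK A *m degsel c a.
Proof.
move=> Ah; apply/matrixP => i j; rewrite mul_diag_mx mul_mx_diag !mxE mulrC.
have [Aij|] := eqVneq ((A i j)@_0) 0; first by rewrite Aij !mul0r.
by move=> /(mhomog_coef0 (Ah i j))/eqP; rewrite subr_eq0 => /eqP ->.
Qed.

Lemma sub_degsel_mxK r s t (b : 'I_r -> zdeg n) (c : 'I_s -> zdeg n) A a
    (X : 'M[K]_(t, r)) :
  mx_homog b c A -> (X <= degsel b a)%MS -> (X *m mxK A <= degsel c a)%MS.
Proof.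
move=> Ah /submxP[Y ->]; rewrite -mulmxA (degsel_mxK _ Ah) mulmxA.
exact: submxMl.
Qed.

(** Comparison maps in both directions compose to a map homotopic to the
    identity, so after setting the variables to zero the homology of [C] embeds
    in that of [D].  In terms of the cycles [Z] and boundaries [B] in degree [a]
    this reads [rank ZC - rank BC <= rank ZD - rank BD]. *)
Lemma hdim_retract M C D g h k a :
    @free_resolution K n M C g -> @free_resolution K n M D h ->
  (hdim C k a <= hdim D k a)%N.
Proof.
move=> CM DM.
have [f [fh f0 fd]] := comparison_exists CM DM (fun _ x => x).
have [e [eh e0 ed]] := comparison_exists DM CM (fun _ x => x).
pose F j := f j *m e j - 1%:M.
have [||| s [sh s0 sS]] := @homotopy_exists _ _ _ _ _ _ _ _ _ F CM CM.
- move=> j; apply: mx_homogD; first exact: mx_homogM (fh j) (eh j).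
  exact/mx_homogN/mx_homog1.
- by move=> x; rewrite mulmxBr mulmx1 raddfB /= mulmxA e0 f0 subrr.
- by move=> j; rewrite mulmxBr mulmxBl mulmxA fd -mulmxA ed mulmxA mulmx1 mul1mx.
pose ZC := (fc_cycles C k :&: fc_comp C k a)%MS.
pose BC := (fc_dK C k :&: fc_comp C k a)%MS.
pose ZD := (fc_cycles D k :&: fc_comp D k a)%MS.
pose BD := (fc_dK D k :&: fc_comp D k a)%MS.
have BZ : (BD <= ZD)%MS.
  apply: capmxS => //; case: (k) => [|j] /=; first exact: submx1.
  by apply/sub_kermxP; rewrite -mxKM (res_dd DM); apply: map_mx0.
have ZZ : (ZC *m mxK (f k) <= ZD)%MS.
  rewrite sub_capmx; apply/andP; split; last first.
    exact: sub_degsel_mxK (fh k) (capmxSr _ _).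
  have: (ZC <= fc_cycles C k)%MS by apply: capmxSl.
  case: {ZC BC ZD BD BZ} (k) {+}ZC => [|j] X /=; first by rewrite submx1 submx1.
  move=> /sub_kermxP XC; apply/sub_kermxP.
  by rewrite -mulmxA -mxKM -fd mxKM mulmxA XC mul0mx.
(* A cycle of [C] that becomes a boundary in [D] is a boundary of [C]. *)
have retr t (X : 'M[K]_(t, _)) :
    (X <= ZC)%MS -> (X *m mxK (f k) <= BD)%MS -> (X <= BC)%MS.
  move=> XZ XB.
  have XC : (X <= fc_comp C k a)%MS by apply: submx_trans XZ (capmxSr _ _).
  rewrite sub_capmx XC andbT.
  have XB' : (X *m mxK (f k) *m mxK (e k) <= fc_dK C k)%MS.
    have /submxP[Y ->] := submx_trans XB (capmxSl _ _).
    by rewrite -mulmxA -mxKM ed mxKM mulmxA submxMl.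
  have -> : X = X *m mxK (f k) *m mxK (e k) - X *m mxK (F k).
    rewrite -mulmxA -mxKM -mulmxBr; apply/esym.
    by rewrite -[RHS]mulmx1 -(mxK1) /F -map_mxB opprB addrC subrK.
  apply: addmx_sub => //; rewrite eqmx_opp.
  have: (X <= fc_cycles C k)%MS by apply: submx_trans XZ (capmxSl _ _).
  case: (k) (X) => [|j] Y /= YZ.
    by rewrite s0 mxKM mulmxA submxMl.
  rewrite sS mxKD !mxKM mulmxDr !mulmxA.
  by move/sub_kermxP: YZ => ->; rewrite mul0mx add0r submxMl.
(* [Q] is the projection to the quotient by the boundaries of [D]. *)
pose Q := cokermx BD.
have E1 := mxrank_mul_ker ZC (mxK (f k) *m Q).
have E2 := mxrank_mul_ker ZD Q.
have L1 : (\rank (ZC :&: kermx (mxK (f k) *m Q))%MS <= \rank BC)%N.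
  apply/mxrankS/retr; first exact: capmxSl.
  rewrite submxE -mulmxA; apply/eqP/sub_kermxP; exact: capmxSr.
have L2 : (\rank (ZC *m (mxK (f k) *m Q)) <= \rank (ZD *m Q))%N.
  by apply: mxrankS; rewrite mulmxA submxMr.
have L3 : (\rank BD <= \rank (ZD :&: kermx Q))%N.
  by apply: mxrankS; rewrite sub_capmx BZ; apply/sub_kermxP; rewrite mulmx_coker.
rewrite /hdim -/ZC -/BC -/ZD -/BD; lia.
Qed.

Lemma hdim_indep M C D g h k a :
    @free_resolution K n M C g -> @free_resolution K n M D h ->
  hdim C k a = hdim D k a.
Proof.
move=> CM DM; apply/eqP.
by rewrite eqn_leq !(hdim_retract _ _ CM DM, hdim_retract _ _ DM CM).
Qed.

Lemma betti_resolution M C g (k : nat) a :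
  @free_resolution K n M C g -> betti M k a = hdim C k a.
Proof.
move=> CM; have [|h DM] := epsilon_spec (inhabits (zero_complex K n))
  (fun C => exists g, @free_resolution K n M C g); first by exists C, g.
exact: hdim_indep DM CM.
Qed.

(** Homological degrees are integers, as for [betti], so that the shifts in
    iterated cones need no case distinction. *)
Definition ncells C (k : int) (a : zdeg n) : nat :=
  match k with Posz k => #|[pred i | @fc_deg _ _ C k i == a]| | Negz _ => 0 end.

Lemma rank_degsel r (b : 'I_r -> zdeg n) a :
  \rank (degsel b a) = #|[pred i | b i == a]|.
Proof.
set S := [pred i | b i == a].
(* The projection factors through the coordinates in [S]. *)
pose A : 'M[K]_(#|S|, r) := \matrix_(i, j) (enum_val i == j)%:R.
have AA : A *m A^T = 1%:M.
  apply/matrixP => i j; rewrite !mxE (bigD1 (enum_val i)) //= big1 ?addr0.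
    by rewrite !mxE eqxx mul1r (inj_eq enum_val_inj) eq_sym.
  by move=> l li; rewrite !mxE eq_sym (negPf li) mul0r.
have DA : degsel b a = A^T *m A.
  apply/matrixP => i j; rewrite !mxE.
  have [ib|ib] := boolP (b i == a); last first.
    rewrite mul0rn big1 // => l _; rewrite !mxE.
    have /negPf -> : enum_val l != i.
      by apply: contra ib => /eqP <-; apply: (enum_valP l).
    by rewrite mul0r.
  have iS : i \in S by [].
  rewrite (bigD1 (enum_rank_in iS i)) //= big1 ?addr0.
    by rewrite !mxE enum_rankK_in // eqxx mul1r.
  move=> l li; rewrite !mxE; have /negPf -> : enum_val l != i; last by rewrite mul0r.
  by apply: contra li => /eqP li; rewrite -(enum_valK_in iS l) li.
have Afree : row_free A by apply/row_freeP; exists A^T.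
rewrite -(eqP Afree); apply/eqmx_rank/andP; split; first by rewrite DA submxMl.
by rewrite -[A in (A <= _)%MS]mul1mx -AA -mulmxA -DA submxMl.
Qed.

Lemma hdim_minimal C k a : minimal_complex C -> hdim C k a = ncells C k a.
Proof.
move=> Cmin.
have dK j : fc_dK C j = 0 by apply/matrixP => i l; rewrite !mxE Cmin.
have -> : hdim C k a = \rank (fc_comp C k a).
  rewrite /hdim dK cap0mx mxrank0 subn0.
  case: k => [|k] /=; first by rewrite cap1mx.
  by apply/eqmx_rank/andP; rewrite capmxSr sub_capmx submx_refl dK kermx0 submx1.
exact: rank_degsel.
Qed.

End Homology.

(** * Mapping cones *)

Section MappingCone.
Variables (K : fieldType) (n : nat).
Local Notation P := {mpoly K[n]}.
Local Notation fcomplex := (fcomplex K n).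

Section Cone.
Variables (M N : grModule K n) (phi : {linear M -> N}).
Variables (C D : fcomplex) (g : 'I_(fc_rk C 0) -> M) (h : 'I_(fc_rk D 0) -> M).
Variable (f : forall k, 'M[P]_(fc_rk C k, fc_rk D k)).
Hypothesis (phih : gr_map phi).
Hypothesis (CB : resolves_sub (fun x => phi x = 0) g) (DM : free_resolution h).
Hypothesis (fcomp : comparison g h f).

Let fh k : mx_homog (@fc_deg _ _ C k) (@fc_deg _ _ D k) (f k).
Proof. by case: fcomp. Qed.
Let f0 x : row_eval h (x *m f 0) = row_eval g x.
Proof. by case: fcomp. Qed.
Let fd k : fc_d C k *m f k = f k.+1 *m fc_d D k.
Proof. by case: fcomp. Qed.

Lemma row_eval_phi r (e : 'I_r -> M) x :
  row_eval (fun i => phi (e i)) x = phi (row_eval e x).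
Proof. by rewrite /row_eval linear_sum; apply: eq_bigr => i _; rewrite linearZ. Qed.

Lemma cone_d_homog k :
  mx_homog (@fc_deg _ _ (cone f) k.+1) (@fc_deg _ _ (cone f) k) (fc_d (cone f) k).
Proof.
case: k => [|k] i j /=.
  by rewrite mxE; case: split => i'; [apply: fh|apply: (res_d_homog DM)].
rewrite !mxE; case: (split i) => i'; rewrite !mxE; case: (split j) => j'.
- by rewrite mxE; apply: mhomogN; apply: (res_d_homog CB).
- exact: fh.
- by rewrite mxE; apply: mhomog0.
- exact: (res_d_homog DM).
Qed.

(** The long exact sequence of a mapping cone, on elements: a cycle [(c, y)] of the
    cone has [c] a cycle of [C], and correcting by a boundary of [C] leaves a
    cycle of [D]. *)
Lemma cone_resolves :
  @resolves_sub _ _ N (fun y => exists x, y = phi x) (cone f) (fun i => phi (h i)).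
Proof.
split.
- exact: cone_d_homog.
- by move=> i; apply: phih; apply: (res_aug_homog DM).
- move=> y; split=> [[x ->]|[x ->]].
    have [z ->] := res_surj DM (y := x) I.
    by exists z; rewrite row_eval_phi.
  by exists (row_eval h x); rewrite row_eval_phi.
- move=> x; rewrite row_eval_phi; split=> [/(res_surj CB)[c]|[y ->]].
    rewrite -f0 => /eqP; rewrite -subr_eq0 -raddfB => /eqP /(res_aug_ker DM)[y E].
    exists (row_mx c y); rewrite [_ *m _]mul_row_col -E addrC; exact/esym/subrK.
  rewrite -[y]hsubmxK [_ *m _]mul_row_col raddfD /= f0 (res_aug_d DM) addr0.
  exact: (res_mem CB).
case=> [|k] x; rewrite -[x]hsubmxK; move: (lsubmx x) (rsubmx x) => {x} c y.
- rewrite [_ *m _]mul_row_col; split=> [E|[z]].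
    have /(res_aug_ker CB)[c' Ec] : row_eval g c = 0.
      rewrite -f0; have /eqP := E; rewrite addr_eq0 => /eqP ->.
      by rewrite raddfN /= (res_aug_d DM) oppr0.
    have [|y' Ey] := res_d_ker DM (x := y + c' *m f 1).
      by rewrite mulmxDl -mulmxA -fd mulmxA -Ec addrC.
    exists (row_mx (- c') y'); rewrite [RHS]mul_row_block mulmxN mulNmx opprK -Ec.
    by rewrite mulmx0 addr0 mulNmx -Ey addrC addrK.
  rewrite -[z]hsubmxK [RHS]mul_row_block mulmxN mulmx0 addr0.
  move=> /eq_row_mx[-> ->].
  by rewrite mulNmx mulmxDl -!mulmxA (res_dd DM) mulmx0 addr0 -fd addNr.
rewrite [_ *m _]mul_row_block mulmx0 addr0 mulmxN -row_mx0; split=> [/eq_row_mx[]|[z]].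
  move=> /eqP; rewrite oppr_eq0 => /eqP /(res_d_ker CB)[c' Ec] E.
  have [|y' Ey] := res_d_ker DM (x := y + c' *m f k.+2).
    by rewrite mulmxDl -mulmxA -fd mulmxA -Ec addrC.
  exists (row_mx (- c') y'); rewrite [RHS]mul_row_block mulmxN mulNmx opprK -Ec.
  by rewrite mulmx0 addr0 mulNmx -Ey addrC addrK.
rewrite -[z]hsubmxK [RHS]mul_row_block mulmxN mulmx0 addr0.
move=> /eq_row_mx[-> ->].
rewrite !mulNmx mulmxDl -!mulmxA (res_dd DM) (res_dd CB) !mulmx0 addr0 oppr0.
by rewrite oppr0 -fd addNr.
Qed.

End Cone.

Lemma ncells_cone (C D : fcomplex) f (k : int) a :
  ncells (@cone K n C D f) k a = (ncells C (k - 1) a + ncells D k a)%N.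
Proof.
case: k => [[|k]|k] //.
have -> : Posz k.+1 - 1 = k by lia.
rewrite /ncells.
rewrite -!sum1_card (eq_bigl (fun i => cone_deg i == a)) //= big_split_ord /=.
congr (_ + _)%N; apply: eq_bigl => i.
  rewrite inE; case: splitP => j /= E; last by have := ltn_ord i; lia.
  by have -> : i = j by apply: val_inj.
rewrite inE; case: splitP => j /= E; first by have := ltn_ord j; lia.
by have -> : i = j by apply: val_inj => /=; lia.
Qed.

(** An entry of [f] with a nonzero constant term is homogeneous of degree zero,
    so it joins basis vectors of equal degrees. *)
Lemma cone_minimal (C D : fcomplex) (f : forall k, 'M[P]_(fc_rk C k, fc_rk D k)) :
    minimal_complex C -> minimal_complex D ->
    (forall k, mx_homog (@fc_deg _ _ C k) (@fc_deg _ _ D k) (f k)) ->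
    (forall k (i : 'I_(fc_rk C k)) (j : 'I_(fc_rk D k)), fc_deg i != fc_deg j) ->
  minimal_complex (cone f).
Proof.
move=> Cmin Dmin fh degCD.
have f0 k i j : (f k i j)@_0%MM = 0.
  apply/eqP; apply: contraNT (degCD k i j) => /(mhomog_coef0 (fh k i j))/eqP.
  by rewrite subr_eq0.
case=> [|k] i j /=; rewrite !mxE; case: (split i) => i'; rewrite ?mxE ?f0 ?Dmin //;
  case: (split j) => j'; rewrite ?mxE ?f0 ?Dmin ?mcoeffN ?Cmin ?oppr0 ?mcoeff0 //.
Qed.

Section IteratedCone.
Variables (E : nat -> grModule K n) (phi : forall k, {linear E k.+1 -> E k}).
Variables (G : nat -> fcomplex) (gam : forall k, 'I_(fc_rk (G k) 0) -> E k.+1).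
Variable (d : nat).
Hypothesis (phih : forall k, gr_map (phi k)).
Hypothesis (phi_inj : forall x : E d.+1, phi d x = 0 -> x = 0).
Hypothesis (phi_exact : forall k, (k < d)%N -> forall x : E k.+1,
  phi k x = 0 <-> exists y : E k.+2, x = phi k.+1 y).
Hypothesis (Gmin : forall k, (k <= d)%N -> minimal_free_resolution (@gam k)).

Let im k (y : E k) := exists x, y = phi k x.

Lemma im_ker k : (k < d)%N -> forall x : E k.+1, im x <-> phi k x = 0.
Proof. by move=> kd x; apply: iff_sym; apply: phi_exact. Qed.

Lemma resolves_sub_iff (M : grModule K n) (B B' : M -> Prop) (C : fcomplex)
    (g : 'I_(fc_rk C 0) -> M) :
  (forall x, B x <-> B' x) -> resolves_sub B g -> resolves_sub B' g.
Proof.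
by move=> BB [? ? H ? ?]; split=> // y; split=> [/BB/H|/H/BB].
Qed.

Lemma iterated_cone_top_resolves :
  resolves_sub (@im d) (fun i => phi d (@gam d i)).
Proof.
have [[H1 H2 H3 H4 H5] _] := Gmin (leqnn d).
split=> //.
- by move=> i; apply: phih.
- move=> y; split=> [[x ->]|[x ->]].
    by have [/(_ I)[z ->] _] := H3 x; exists z; rewrite row_eval_phi.
  by exists (row_eval (@gam d) x); rewrite row_eval_phi.
move=> x; rewrite row_eval_phi -H4; split=> [/phi_inj //|->]; exact: raddf0.
Qed.

Lemma iterated_cone_resolves k C g :
  @iterated_cone K n E phi G gam d k C g -> resolves_sub (@im k) g.
Proof.
elim=> [|{}k {}C {}g f kd _ IH fcomp]; first exact: iterated_cone_top_resolves.
apply: cone_resolves fcomp => //; last by case: (Gmin (ltnW kd)).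
exact: resolves_sub_iff (im_ker kd) IH.
Qed.

Lemma iterated_cone_exists k : (k <= d)%N ->
  exists C g, @iterated_cone K n E phi G gam d k C g.
Proof.
move=> kd; rewrite -(subKn kd); elim: (d - k)%N (leq_subr k d) => [|j IH] jd.
  by rewrite subn0; exists (G d), (fun i => phi d (gam i)); apply: iterated_cone_top.
have [C [g Cg]] := IH (ltnW jd).
have jE : (d - j = (d - j.+1).+1)%N by lia.
move: Cg; move: C g; rewrite jE => C g Cg.
have ld : (d - j.+1 < d)%N by lia.
have [f fcomp] := comparison_exists (iterated_cone_resolves Cg)
  (Gmin (ltnW ld)).1 (fun _ _ => I).
by exists (cone f), (fun i => phi _ (gam i)); apply: iterated_cone_step fcomp.
Qed.

(** Each cone step shifts the homological degree by one. *)
Lemma ncells_iterated_cone k C g : @iterated_cone K n E phi G gam d k C g ->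
  forall (t : int) a,
  ncells C t a = (\sum_(i < d.+1 - k) ncells (G (k + i)) (t - i%:Z) a)%N.
Proof.
elim=> [|{}k {}C {}g f kd _ IH fcomp] t a.
  by rewrite subSnn big_ord1 addn0 subr0.
have -> : (d.+1 - k = (d.+1 - k.+1).+1)%N by lia.
rewrite ncells_cone IH big_ord_recl addn0 subr0 addnC; congr (_ + _)%N.
apply: eq_bigr => i _; rewrite /= /bump /= add1n addnS; congr ncells; lia.
Qed.

(** The complex resolving the image of [phi k.+1] is made of the [G j] with
    [j > k], so its degrees have weights above [k] and differ from those of
    [G k]. *)
Lemma iterated_cone_minimal (w : zdeg n -> nat) :
    (forall k, (k <= d)%N -> forall t (i : 'I_(fc_rk (G k) t)), w (fc_deg i) = k) ->
  forall k C g, @iterated_cone K n E phi G gam d k C g -> minimal_complex C.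
Proof.
move=> wG k C g Cg.
suff : minimal_complex C /\
    forall t (i : 'I_(fc_rk C t)), (k <= w (fc_deg i))%N by case.
elim: Cg => [|{}k {}C {}g f kd _ [Cmin Cw] [fh _ _]].
  by split=> [|t i]; [case: (Gmin (leqnn d))|rewrite wG].
split.
  apply: cone_minimal => //; first by case: (Gmin (ltnW kd)).
  move=> t i j; apply: contraTneq (Cw t i) => ->.
  by rewrite (wG k (ltnW kd)) ltnn.
case=> [|t] i /=; first by rewrite (wG k (ltnW kd)).
by case: split => j; [exact/ltnW/Cw|rewrite (wG k (ltnW kd))].
Qed.

End IteratedCone.
End MappingCone.

(** * Minimal resolutions with bounded degrees *)

Section FiniteGeneration.
Variables (K : fieldType) (n : nat).
Local Notation P := {mpoly K[n]}.

(** The value at the point with all coordinates one reads off the coefficient of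
    a homogeneous polynomial. *)
Definition unit_eval : P -> K := meval (fun _ => 1).

Lemma unit_eval_eq0 a (p : P) : mhomog a p -> unit_eval p = 0 -> p = 0.
Proof.
move=> pa; have [//|] := eqVneq p 0; rewrite -msupp_eq0.
case E: (msupp p) => [//|u s] _.
have pu : p@_u != 0 by rewrite -mcoeff_msupp E mem_head.
have [_ ->] := mhomog_coef pa pu.
rewrite /unit_eval mevalZ mevalX big1 => [|i _]; last by rewrite expr1n.
by rewrite mulr1 => ->; rewrite scale0r.
Qed.

(** Evaluation embeds the elements of degree [a] in [K^r], so finitely many
    elements of [V] whose values have maximal rank span [V] over [K]. *)
Lemma homog_finite_dim r (c : 'I_r -> zdeg n) a (V : 'rV[P]_r -> Prop) :
    (forall x, V x -> row_homog c a x) ->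
  exists t (S : 'I_t -> 'rV[P]_r), (forall i, V (S i)) /\
    forall x, V x -> exists k : 'I_t -> K, x = \sum_i (k i)%:MP *: S i.
Proof.
move=> Vh.
pose ev t (S : 'I_t -> 'rV[P]_r) : 'M[K]_(t, r) := \matrix_(i, j) unit_eval (S i 0 j).
pose Q m := `[< exists t (S : 'I_t -> 'rV[P]_r),
  (forall i, V (S i)) /\ \rank (ev t S) = m >].
have Q0 : exists m, Q m.
  exists 0%N; apply/asboolP; exists 0%N, (fun _ => 0); split; first by case.
  by apply/eqP; rewrite -leqn0 rank_leq_row.
have Qr m : Q m -> (m <= r)%N by move=> /asboolP[t [S [_ <-]]]; apply: rank_leq_col.
case: (ex_maxnP Q0 Qr) => m /asboolP[t [S [VS Sm]]] max.
exists t, S; split=> // x Vx.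
have [/submxP[k Ek]|no] := boolP (\row_j unit_eval (x 0 j) <= ev t S)%MS.
  exists (fun i => k 0 i).
  have xj j : x 0 j = \sum_i (k 0 i)%:MP * S i 0 j.
    apply/eqP; rewrite -subr_eq0; apply/eqP.
    apply: (@unit_eval_eq0 (a - c j)).
      apply: mhomogB; first exact: Vh.
      apply: mhomog_sum => i; rewrite mul_mpolyC; apply: mhomogZ.
      by have := Vh _ (VS i) j.
    have /rowP/(_ j) := Ek; rewrite !mxE /unit_eval mevalB => ->.
    apply/eqP; rewrite subr_eq0 raddf_sum /=; apply/eqP; apply: eq_bigr => i _.
    by rewrite mxE mevalM mevalC.
  by apply/rowP => j; rewrite xj summxE; apply: eq_bigr => i _; rewrite mxE.
(* An element outside the span would raise the rank. *)
have /max : Q (\rank (col_mx (ev t S) (\row_j unit_eval (x 0 j)))).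
  apply/asboolP; exists (t + 1)%N.
  exists (fun i => match split i with inl i => S i | inr _ => x end).
  split; first by move=> i; case: split => // j; apply: VS.
  congr (\rank _); apply/matrixP => i j; rewrite !mxE.
  by case: split => i'; rewrite mxE.
rewrite -Sm leqNgt; case/negP; rewrite -addsmxE ltn_neqAle mxrankS ?addsmxSl // andbT.
apply: contra no => /eqP E.
have : (ev t S == ev t S + \row_j unit_eval (x 0 j))%MS.
  have [_ <-] := mxrank_leqif_eq (addsmxSl (ev t S) (\row_j unit_eval (x 0 j))).
  by rewrite E.
by move=> /andP[_]; apply: submx_trans; apply: addsmxSr.
Qed.

Section Span.
Variable (r : nat).
Implicit Types (x : 'rV[P]_r) (I : finType).

Definition fspan I (G : I -> 'rV[P]_r) x := exists y : I -> P, x = \sum_i y i *: G i.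

Lemma fspan0 I (G : I -> 'rV[P]_r) : fspan G 0.
Proof. by exists (fun _ => 0); rewrite big1 // => i _; rewrite scale0r. Qed.

Lemma fspanD I (G : I -> 'rV[P]_r) x x' : fspan G x -> fspan G x' -> fspan G (x + x').
Proof.
move=> [y ->] [y' ->]; exists (fun i => y i + y' i); rewrite -big_split.
by apply: eq_bigr => i _; rewrite scalerDl.
Qed.

Lemma fspanZ I (G : I -> 'rV[P]_r) p x : fspan G x -> fspan G (p *: x).
Proof.
move=> [y ->]; exists (fun i => p * y i); rewrite scaler_sumr.
by apply: eq_bigr => i _; rewrite scalerA.
Qed.

Lemma fspan_sum I (G : I -> 'rV[P]_r) (J : Type) (s : seq J) (Q : pred J)
    (F : J -> 'rV[P]_r) :
  (forall j, Q j -> fspan G (F j)) -> fspan G (\sum_(j <- s | Q j) F j).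
Proof. by move=> GF; apply: big_ind => //; [apply: fspan0|apply: fspanD]. Qed.

Lemma fspan_mem I (G : I -> 'rV[P]_r) i : fspan G (G i).
Proof.
exists (fun j => (j == i)%:R); rewrite (bigD1 i) //= eqxx scale1r big1 ?addr0 //.
by move=> j /negPf ->; rewrite scale0r.
Qed.

Lemma fspan_trans I (J : finType) (G : I -> 'rV[P]_r) (H : J -> 'rV[P]_r) x :
  (forall i, fspan H (G i)) -> fspan G x -> fspan H x.
Proof. by move=> GH [y ->]; apply: fspan_sum => i _; apply: fspanZ. Qed.

End Span.

(** The free module with basis degrees [sz_deg], and a submodule of it.  The
    resolution is built by passing repeatedly from such a submodule to the
    relations between its minimal generators. *)
Record syzygies := Syzygies {
  sz_rk : nat;
  sz_deg : 'I_sz_rk -> zdeg n;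
  sz_mem : 'rV[P]_sz_rk -> Prop }.

Section Bounded.
Variable N : 'X_{1..n}.

(** Multiplication by a variable [v] is bijective on the quotient of a free
    module with degrees bounded by [N] by such a submodule, in all degrees with
    [v]-coordinate at least [N v]. *)
Definition bounded (Z : syzygies) : Prop :=
  [/\ forall i, exists2 u, (u <= N)%MM & @sz_deg Z i = deg_mon u,
      @sz_mem Z 0,
      forall p x y, sz_mem x -> sz_mem y -> @sz_mem Z (p *: x + y),
      forall a x, sz_mem x -> @sz_mem Z (row_hcomp (@sz_deg Z) a x)
    & forall (w c : 'X_{1..n}) x, row_homog (@sz_deg Z) (deg_mon c) x ->
        (forall v, 0 < w v -> N v <= c v)%N ->
        sz_mem ('X_[w] *: x) -> @sz_mem Z x].

(** If [A] is the degree of [x], all nonzero entries of [x] are divisible by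
    [x^w] with [w = A - N] truncated at zero, because the basis degrees are
    bounded by [N]. *)
Lemma homog_bounded_degree r (b : 'I_r -> zdeg n) a (x : 'rV[P]_r) :
    (forall i, exists2 u, (u <= N)%MM & b i = deg_mon u) ->
    row_homog b a x -> x != 0 ->
  exists (w c : 'X_{1..n}) x', [/\ (c <= N)%MM, forall v, (0 < w v -> N v <= c v)%N,
    row_homog b (deg_mon c) x' & x = 'X_[w] *: x'].
Proof.
move=> bN xa /rV0Pn[j xj].
have deg i : x 0 i != 0 ->
    exists2 u, x 0 i = (x 0 i)@_u *: 'X_[u] & a = deg_mon u + b i.
  rewrite -msupp_eq0; case E: (msupp _) => [//|u s] _; exists u.
    by apply: (mhomog_coef (xa i) _).2; rewrite -mcoeff_msupp E mem_head.
  by rewrite (xa i u) ?subrK // E mem_head.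
have [u0 _ au0] := deg j xj; have [uj _ buj] := bN j.
pose A := (u0 + uj)%MM; have aA : a = deg_mon A by rewrite deg_monD -buj.
pose w := (A - N)%MM; pose c := (A - w)%MM.
have cw : (c + w)%MM = A by rewrite submK //; apply: lem_subr.
have div i : exists q, mhomog (deg_mon c - b i) q /\ x 0 i = 'X_[w] * q.
  have [->|/deg[u xu au]] := eqVneq (x 0 i) 0.
    by exists 0; rewrite mulr0; split=> //; apply: mhomog0.
  have [ui uiN bi] := bN i.
  have Au : (u + ui)%MM = A by apply: deg_mon_inj; rewrite deg_monD -bi -aA au.
  have wu : (w <= u)%MM.
    apply/mnm_lepP => v; rewrite mnmBE -Au mnmDE.
    by have /mnm_lepP/(_ v) := uiN; lia.
  exists ((x 0 i)@_u *: 'X_[u - w]); split.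
    have -> : deg_mon c - b i = deg_mon (u - w)%MM; last exact: mhomog_term.
    apply/eqP; rewrite subr_eq bi -deg_monD; apply/eqP; congr deg_mon.
    apply/mnmP => v; rewrite mnmDE !mnmBE -Au mnmDE.
    by have /mnm_lepP/(_ v) := wu; rewrite mnmBE -Au mnmDE; lia.
  by rewrite {1}xu -scalerAr -mpolyXD addmC submK.
have [q qP] := choice div.
exists w, c, (\row_i q i); split.
- by apply/mnm_lepP => v; rewrite !mnmBE; lia.
- by move=> v; rewrite !mnmBE; lia.
- by move=> i; rewrite mxE; case: (qP i).
- by apply/rowP => i; rewrite !mxE; case: (qP i).
Qed.

Definition generates (Z : syzygies) (I : finType) (b : I -> zdeg n)
    (G : I -> 'rV[P]_(sz_rk Z)) :=
  [/\ forall i, exists2 u, (u <= N)%MM & b i = deg_mon u,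
      forall i, row_homog (@sz_deg Z) (b i) (G i),
      forall i, sz_mem (G i)
    & forall x, sz_mem x -> fspan G x].

(** Finitely many degrees bounded by [N] occur, and in each of them finitely many
    elements suffice. *)
Lemma bounded_fg Z : bounded Z -> exists (I : finType) b G, @generates Z I b G.
Proof.
move=> [degN Z0 Zlin Zcomp Zclos].
pose V c x := row_homog (@sz_deg Z) (deg_mon c) x /\ sz_mem x.
have fd c : exists t (S : 'I_t -> 'rV[P]_(sz_rk Z)), (forall i, V c (S i)) /\
    forall x, V c x -> exists k : 'I_t -> K, x = \sum_i (k i)%:MP *: S i.
  by apply: (@homog_finite_dim _ (@sz_deg Z) (deg_mon c)) => x [].
pose t c := projT1 (cid (fd c)).
pose S c : 'I_(t c) -> 'rV[P]_(sz_rk Z) := projT1 (cid (projT2 (cid (fd c)))).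
have SV c : forall i, V c (S c i) := (projT2 (cid (projT2 (cid (fd c))))).1.
have Sgen c x : V c x -> exists k : 'I_(t c) -> K, x = \sum_i (k i)%:MP *: S c i.
  exact: (projT2 (cid (projT2 (cid (fd c))))).2.
pose box := {c : 'X_{1..n < (mdeg N).+1} | (c <= N)%MM}.
pose I : finType := {c : box & 'I_(t (val c))}.
pose G (i : I) := S (val (tag i)) (tagged i).
exists I, (fun i : I => deg_mon (val (tag i))), G; split.
- by move=> i; exists (val (tag i)) => //; apply: (valP (tag i)).
- by move=> i; case: (SV _ (tagged i)).
- by move=> i; case: (SV _ (tagged i)).
move=> x Zx; have [s [_ _ ->]] := row_hcomp_decomp (@sz_deg Z) x [::].
apply: fspan_sum => a _; set xa := row_hcomp _ a x.
have Zxa : sz_mem xa by apply: Zcomp.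
have [->|xa0] := eqVneq xa 0; first exact: fspan0.
have [w [c [x' [cN wc x'c E]]]] :=
  homog_bounded_degree degN (row_hcomp_homog (x := x) (a := a)) xa0.
rewrite -/xa in E; rewrite E in Zxa *; apply: fspanZ.
have [k ->] : exists k : 'I_(t c) -> K, x' = \sum_i (k i)%:MP *: S c i.
  by apply: Sgen; split=> //; apply: Zclos Zxa.
apply: fspan_sum => i _; apply: fspanZ.
have cb : (mdeg c < (mdeg N).+1)%N.
  by rewrite ltnS -(submK cN) mdegD leq_addl.
pose cbox : box := exist _ (BMultinom cb) cN.
exact: (fspan_mem G (Tagged (fun c : box => 'I_(t (val c))) (i : 'I_(t (val cbox))))).
Qed.

(** The component of the relation in the degree of the generator [G i] has a
    nonzero constant as its [i]-th entry, by which one can divide. *)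
Lemma generates_redundant (Z : syzygies) r (b : 'I_r -> zdeg n)
    (G : 'I_r -> 'rV[P]_(sz_rk Z)) (y : 'rV[P]_r) i :
    generates b G -> \sum_j y 0 j *: G j = 0 -> (y 0 i)@_0%MM != 0 ->
  exists b' G', @generates Z 'I_r.-1 b' G'.
Proof.
case: r => [|r] in b G y i *; first by case: i.
move=> [bN Gh Gm Gg] y0 yi.
pose A : 'M[P]_(r.+1, _) := \matrix_i G i.
have yA (z : 'rV_r.+1) : z *m A = \sum_i z 0 i *: G i.
  by rewrite mulmx_sum_row; apply: eq_bigr => j _; rewrite rowK.
have Ah : mx_homog b (@sz_deg Z) A by apply/mx_homogP => j; rewrite rowK.
have {y0} : row_hcomp b (b i) y *m A = 0.
  by rewrite -(row_hcompM _ _ Ah) yA y0; apply/rowP => j; rewrite !mxE hcomp0.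
set y' := row_hcomp b (b i) y; set c := (y 0 i)@_0%MM in yi.
have y'i : y' 0 i = c%:MP.
  rewrite mxE subrr; apply/mpolyP => u; rewrite mcoeff_hcomp mcoeffC.
  rewrite -(deg_mon0 n) (inj_eq (@deg_mon_inj n)) eq_sym.
  by case: eqP => [<-|_]; rewrite ?mulr1 ?mulr0.
rewrite yA (bigD1_ord i) //= y'i addrC => /eqP; rewrite addr_eq0 => /eqP E.
pose G' (j : 'I_r) := G (lift i j).
exists (fun j => b (lift i j)), G'; split=> [j|j|j|x /Gg].
- exact: bN.
- exact: Gh.
- exact: Gm.
apply: fspan_trans => j; case: (unliftP i j) => [j' ->|->]; first exact: (fspan_mem G').
have -> : G i = (- c^-1)%:MP *: \sum_(l < r) y' 0 (lift i l) *: G' l.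
  by rewrite E scalerN scalerA -mpolyCM mulNr mulVf // mpolyCN scaleN1r opprK.
by apply/fspanZ/fspan_sum => l _; apply/fspanZ/fspan_mem.
Qed.

(** The generators are a list of minimal length, from which none can be
    dropped. *)
Lemma bounded_minimal_gens Z : bounded Z ->
  exists r (b : 'I_r -> zdeg n) (A : 'M[P]_(r, sz_rk Z)),
  [/\ forall i, exists2 u, (u <= N)%MM & b i = deg_mon u,
      mx_homog b (@sz_deg Z) A,
      forall x, sz_mem x <-> exists y, x = y *m A
    & forall y : 'rV_r, y *m A = 0 -> forall i, (y 0 i)@_0%MM = 0].
Proof.
move=> bZ; have [degN Z0 Zlin Zcomp Zclos] := bZ.
pose Q m := `[< exists b G, @generates Z 'I_m b G >].
have Qex : exists m, Q m.
  have [I [b [G [bN Gh Gm Gg]]]] := bounded_fg bZ.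
  exists #|I|; apply/asboolP; exists (b \o enum_val), (G \o enum_val).
  split=> [i|i|i|x /Gg]; [exact: bN|exact: Gh|exact: Gm|].
  apply: fspan_trans => i; rewrite -(enum_rankK i).
  exact: (fspan_mem (G \o enum_val)).
case: (ex_minnP Qex) => r /asboolP[b [G Ggen]] rmin; have [bN Gh Gm Gg] := Ggen.
pose A : 'M[P]_(r, _) := \matrix_i G i.
have yA (y : 'rV_r) : y *m A = \sum_i y 0 i *: G i.
  by rewrite mulmx_sum_row; apply: eq_bigr => i _; rewrite rowK.
exists r, b, A; split=> // [|x|y y0 i].
- by apply/mx_homogP => i; rewrite rowK.
- split=> [/Gg[y ->]|[y ->]].
    by exists (\row_i y i); rewrite yA; apply: eq_bigr => i _; rewrite mxE.
  rewrite yA; elim/big_rec: _ => // i x' _; exact: Zlin.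
apply/eqP/negPn/negP => yi; rewrite yA in y0.
have /asboolP/rmin := generates_redundant Ggen y0 yi.
by case: r i {b G Ggen rmin bN Gh Gm Gg A yA y y0 yi} => [[]//|r] _; rewrite ltnn.
Qed.

(** Closedness under division by monomials is automatic for kernels, as free
    modules are torsion-free. *)
Lemma bounded_ker r (b : 'I_r -> zdeg n) s (c : 'I_s -> zdeg n) (A : 'M[P]_(r, s)) :
    (forall i, exists2 u, (u <= N)%MM & b i = deg_mon u) -> mx_homog b c A ->
  bounded (Syzygies b (fun y : 'rV_r => y *m A = 0)).
Proof.
move=> bN Ah; split=> //= [|p x y xA yA|a x xA|w e x _ _ xA].
- exact: mul0mx.
- by rewrite mulmxDl -scalemxAl xA yA scaler0 addr0.
- by rewrite -(row_hcompM _ _ Ah) xA; apply/rowP => j; rewrite !mxE hcomp0.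
apply/rowP => j; move/rowP/(_ j): xA; rewrite -scalemxAl !mxE => /eqP.
rewrite mulf_eq0 => /orP[/eqP/(congr1 (mcoeff w))|/eqP //].
by rewrite mcoeffX eqxx mcoeff0 => /eqP; rewrite oner_eq0.
Qed.

(** The ideals [J] are those for which multiplication by a variable [v] is
    bijective on [P/J] in all degrees with [v]-coordinate at least [N v]. *)
Lemma minimal_resolution_exists (J : monIdeal K n) :
    (forall w c : 'X_{1..n}, J 'X_[w + c] ->
      (forall v, 0 < w v -> N v <= c v)%N -> J 'X_[c]) ->
  exists C (g : 'I_(fc_rk C 0) -> gm_quot J), minimal_free_resolution g /\
    forall k (i : 'I_(fc_rk C k)), exists2 u, (u <= N)%MM & fc_deg i = deg_mon u.
Proof.
move=> JN; have [J1|J1] := EM (J 1).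
  (* Here [P/J] is zero, and a generator would not be minimal. *)
  exists (zero_complex K n), (fun _ => 0).
  split; last by move=> k; case.
  split; last by move=> k; case.
  have x0 (x : 'rV[P]_0) : x = 0 by apply/rowP; case.
  split; try by [move=> k; case|case].
  - move=> y; split=> // _; exists 0; rewrite raddf0.
    elim/mquotW: y => p; apply/mclassP; rewrite subr0 -[p]mulr1; exact: miM.
  - by move=> x; split=> _; [exists 0; rewrite [x]x0 mul0mx|rewrite [x]x0 raddf0].
  by move=> k x; split=> _; [exists 0; rewrite [x]x0 mul0mx|rewrite [x]x0 mul0mx].
pose gok (Z : syzygies) := exists g : 'I_(sz_rk Z) -> gm_quot J,
  [/\ forall i, gm_hom (@sz_deg Z i) (g i), forall y, exists x, y = row_eval g x
    & forall x, row_eval g x = 0 <-> sz_mem x].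
pose minZ (Z : syzygies) := forall x : 'rV_(sz_rk Z), sz_mem x ->
  forall i : 'I_(sz_rk Z), (x 0 i)@_0%MM = 0.
pose Inv (k : nat) (Z : syzygies) := [/\ bounded Z, minZ Z & k = 0%N -> gok Z].
pose R (k : nat) (Z Z' : syzygies) := exists A : 'M[P]_(sz_rk Z', sz_rk Z),
  [/\ mx_homog (@sz_deg Z') (@sz_deg Z) A,
      forall x, sz_mem x <-> exists y, x = y *m A
    & forall y, @sz_mem Z' y <-> y *m A = 0].
have [|k Z [bZ minZZ _]|Z [ZI ZR]] :=
  @dependent_choice (fun _ => syzygies) Inv R.
- (* The first step is [J] as the kernel of [P -> P/J]. *)
  exists (Syzygies (fun _ : 'I_1 => 0) (fun x => J (x 0 0))).
  have ev x : row_eval (fun _ : 'I_1 => mclass J 1 : gm_quot J) x = mclass J (x 0 0).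
    rewrite /row_eval big_ord1 -[_ *: _]/(mquot_scale _ _) mclassZ mulr1 //.
  split=> [|x /= Jx i|_].
  + split=> [i||p x y Jx Jy|a x Jx|w c x xh wN /=].
    * by exists 0%MM; [apply/mnm_lepP => v; rewrite mnm0E|rewrite deg_mon0].
    * by rewrite /= mxE; apply: mi0.
    * by rewrite /= !mxE; apply/miD/Jy/miM.
    * rewrite /= mxE; apply/monIdealP => u.
      rewrite mcoeff_msupp mcoeff_hcomp; case: ifP; rewrite ?eqxx // -mcoeff_msupp => _.
      by move/monIdealP: Jx; apply.
    rewrite mxE => Jx; apply/monIdealP => u ux; apply: (JN w).
      move/monIdealP: Jx; apply; rewrite mulrC (perm_mem (msuppMX _ _)); apply/mapP.
      by exists u.
    by have -> : u = c by apply: deg_mon_inj; rewrite (xh 0 u ux) subr0.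
  + rewrite ord1; apply/eqP/negPn/negP => x0; apply: J1; rewrite -mpolyX0.
    by move/monIdealP: Jx; apply; rewrite mcoeff_msupp.
  exists (fun _ => mclass J 1); split=> [_|y|x] /=.
  + by exists 1 => //; apply: mhomog1.
  + by elim/mquotW: y => p; exists (const_mx p); rewrite ev mxE.
  + rewrite ev; split=> [/mclassP|Jx]; first by rewrite subr0.
    by apply/mclassP; rewrite subr0.
- have [r [b [A [bN Ah Aim Amin]]]] := bounded_minimal_gens bZ.
  exists (Syzygies b (fun y => y *m A = 0)); first by exists A.
  by split=> //; apply: bounded_ker Ah.
pose A k := projT1 (cid (ZR k)).
have Ah k : mx_homog (@sz_deg (Z k.+1)) (@sz_deg (Z k)) (A k).
  by case: (projT2 (cid (ZR k))).
have Aim k x : @sz_mem (Z k) x <-> exists y, x = y *m A k.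
  by case: (projT2 (cid (ZR k))).
have Aker k y : @sz_mem (Z k.+1) y <-> y *m A k = 0.
  by case: (projT2 (cid (ZR k))).
have [_ _ /(_ erefl)[g [gh gs gk]]] := ZI 0%N.
exists (FComplex (fun k => @sz_deg (Z k)) A), g; split; last first.
  by move=> k i; have [[degN _ _ _ _] _ _] := ZI k; apply: degN.
split=> [|k i j /=]; last first.
  have [_ Zmin _] := ZI k; have := Zmin (row i (A k)) _ j; rewrite mxE; apply.
  by apply/Aim; exists (delta_mx 0 i); rewrite rowE.
split=> //.
- by move=> x; rewrite gk Aim.
- by move=> k x; rewrite -Aker Aim.
Qed.

End Bounded.
End FiniteGeneration.

(** * Resolutions of shifts and direct sums *)

Section Shift.
Variables (K : fieldType) (n : nat).
Local Notation fcomplex := (fcomplex K n).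

Definition fc_shift (C : fcomplex) (b : zdeg n) : fcomplex :=
  @FComplex K n (fc_rk C) (fun k i => fc_deg i - b) (fc_d C).

Lemma shift_resolution (M : grModule K n) (C : fcomplex) (b : zdeg n)
    (g : 'I_(fc_rk C 0) -> M) :
  minimal_free_resolution g ->
  @minimal_free_resolution K n (gm_shift M b) (fc_shift C b) g.
Proof.
move=> [[Ch gh gs gk Ck] Cmin]; split=> //; split=> //.
  by move=> k i j; rewrite /= opprB addrA subrK; apply: Ch.
by move=> i; rewrite /= subrK; apply: gh.
Qed.

Lemma ncells_shift (C : fcomplex) b k a : ncells (fc_shift C b) k a = ncells C k (a + b).
Proof.
case: k => k //=; apply: eq_card => i; rewrite !inE /=.
by rewrite subr_eq.
Qed.

End Shift.

Section DirectSum.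
Variables (K : fieldType) (n : nat).
Local Notation P := {mpoly K[n]}.
Local Notation fcomplex := (fcomplex K n).
Variables (U : finType) (M : U -> grModule K n) (R : U -> fcomplex).
Variable g : forall u, 'I_(fc_rk (R u) 0) -> M u.

Definition dcell k : finType := {u : U & 'I_(fc_rk (R u) k)}.

Local Notation cell j := (Tagged (fun u => 'I_(fc_rk (R u) _)) j).

(** [untag] vanishes off the diagonal blocks. *)
Definition dsum_d k : 'M[P]_(#|dcell k.+1|, #|dcell k|) := \matrix_(i, j)
  untag 0 (fun i' => fc_d (R _) k i' (tagged (enum_val j))) (enum_val i).

Definition fc_dsum : fcomplex :=
  @FComplex K n (fun k => #|dcell k|) (fun k i => fc_deg (tagged (enum_val i))) dsum_d.

Definition dsum_aug (i : 'I_(fc_rk fc_dsum 0)) : gm_dsum M :=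
  [ffun u => untag 0 (@g u) (enum_val i)].

Definition cell_row k (x : 'rV[P]_#|dcell k|) u : 'rV[P]_(fc_rk (R u) k) :=
  \row_j x 0 (enum_rank (cell j)).

Definition glue_rows k (y : forall u, 'rV[P]_(fc_rk (R u) k)) : 'rV[P]_#|dcell k| :=
  \row_i y _ 0 (tagged (enum_val i)).

Lemma glue_rowsK k y u : cell_row (@glue_rows k y) u = y u.
Proof. by apply/rowP => j; rewrite !mxE enum_rankK. Qed.

Lemma cell_rowP k (x x' : 'rV[P]_#|dcell k|) :
  (forall u, cell_row x u = cell_row x' u) -> x = x'.
Proof.
move=> xx; apply/rowP => i; have /rowP/(_ (tagged (enum_val i))) := xx (tag (enum_val i)).
by rewrite !mxE taggedK enum_valK.
Qed.

Lemma sum_cells (V : nmodType) k w (F : 'rV[P]_#|dcell k|) (H : 'I_(fc_rk (R w) k) -> V)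
    (s : P -> V -> V) : (forall p, s p 0 = 0) ->
  \sum_i s (F 0 i) (untag 0 H (enum_val i)) = \sum_j s (cell_row F w 0 j) (H j).
Proof.
move=> s0; rewrite (reindex (@enum_rank (dcell k))); last first.
  exact/onW_bij/enum_rank_bij.
pose G (c : dcell k) := s (F 0 (enum_rank c)) (untag 0 H c).
rewrite (eq_bigr (fun c => G (cell (tagged c)))); last first.
  by move=> c _; rewrite taggedK enum_rankK.
rewrite -(sig_big_dep (fun _ => true) (fun _ _ => true) (fun u j => G (cell j))) /=.
rewrite (bigD1 w) //= [X in _ + X]big1 ?addr0.
  by apply: eq_bigr => j _; rewrite /G mxE (untagE _ _ (erefl : tag (cell j) = w)).
move=> u uw; rewrite big1 // => j _.
by rewrite /G untag_dflt ?s0.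
Qed.

Lemma cell_row_mul k (x : 'rV[P]_#|dcell k.+1|) u :
  cell_row (x *m dsum_d k) u = cell_row x u *m fc_d (R u) k.
Proof.
apply/rowP => j; rewrite !mxE.
under eq_bigr => i _ do rewrite mxE enum_rankK /=.
exact: (sum_cells x (fun i' => fc_d (R u) k i' j) (s := *%R) (@mulr0 _)).
Qed.

Lemma row_eval_dsum x u : row_eval dsum_aug x u = row_eval (@g u) (cell_row x u).
Proof.
rewrite /row_eval dsum_sumE; under eq_bigr => i _ do rewrite dsumZE ffunE.
exact: (sum_cells x (@g u) (s := fun p y => p *: y) (@scaler0 _ _)).
Qed.

Lemma dsum_resolution :
    (forall u, minimal_free_resolution (@g u)) ->
  minimal_free_resolution dsum_aug.
Proof.
move=> gmin.
have gR u : free_resolution (@g u) by case: (gmin u).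
have glue k (Q : forall u, 'rV[P]_(fc_rk (R u) k) -> Prop) :
    (forall u, exists y, Q u y) -> exists y, forall u, Q u (@cell_row k y u).
  move=> Qex; pose y u := projT1 (cid (Qex u)).
  exists (glue_rows y) => u; rewrite glue_rowsK; exact: (projT2 (cid (Qex u))).
split; last first.
  move=> k i j; rewrite mxE /untag; case: eqP => [e|_]; last exact: mcoeff0.
  by case: (gmin (tag (enum_val j))) => _; apply.
split.
- move=> k i j; rewrite mxE /untag; case: eqP => [e|_]; last exact: mhomog0.
  have -> : @fc_deg _ _ fc_dsum k.+1 i = fc_deg (etagged e).
    by rewrite /=; case: _ / e.
  by apply: (res_d_homog (gR _)).
- move=> i u; rewrite ffunE /untag; case: eqP => [e|_]; last exact: gm_hom0.
  have -> : @fc_deg _ _ fc_dsum 0 i = fc_deg (etagged e).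
    by rewrite /=; case: _ / e.
  exact: (res_aug_homog (gR _)).
- move=> y; split=> // _.
  have [|x xP] := @glue 0%N (fun u x => y u = row_eval (@g u) x).
    by move=> u; apply: (res_surj (gR u)).
  by exists x; apply/ffunP => u; rewrite row_eval_dsum.
- move=> x; split=> [x0|[y ->]]; last first.
    apply/ffunP => u; rewrite row_eval_dsum cell_row_mul dsum0E.
    exact: (res_aug_d (gR u)).
  have [|y yP] := @glue 1%N (fun u y => cell_row x u = y *m fc_d (R u) 0).
    by move=> u; apply: (res_aug_ker (gR u)); rewrite -row_eval_dsum x0 dsum0E.
  by exists y; apply: cell_rowP => u; rewrite cell_row_mul.
move=> k x; split=> [x0|[y ->]]; last first.
  apply: cell_rowP => u; rewrite !cell_row_mul -mulmxA (res_dd (gR u)) mulmx0.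
  by apply/rowP => j; rewrite !mxE.
have [|y yP] := @glue k.+2 (fun u y => cell_row x u = y *m fc_d (R u) k.+1).
  move=> u; apply: (res_d_ker (gR u)); rewrite -cell_row_mul.
  by apply/rowP => j; move/rowP: x0 => /(_ (enum_rank (cell j))); rewrite !mxE.
by exists y; apply: cell_rowP => u; rewrite cell_row_mul.
Qed.

Lemma ncells_dsum (k : int) a : ncells fc_dsum k a = (\sum_u ncells (R u) k a)%N.
Proof.
case: k => k /=; last by rewrite big1.
rewrite -sum1_card big_mkcond /= (reindex (@enum_rank (dcell k))); last first.
  exact/onW_bij/enum_rank_bij.
rewrite (eq_bigr (fun c : dcell k => if fc_deg (tagged c) == a then 1 else 0)%N).
  rewrite -(sig_big_dep (fun _ => true) (fun _ _ => true)
    (fun u (j : 'I_(fc_rk (R u) k)) => if fc_deg j == a then 1 else 0)%N) /=.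
  by apply: eq_bigr => u _; rewrite -sum1_card [RHS]big_mkcond.
by move=> c _; rewrite inE /= enum_rankK.
Qed.

End DirectSum.

(** * Monomials of the ideals *)

Section MonomialsOfIdeals.
Variables (K : fieldType) (n : nat).
Implicit Types (I J : monIdeal K n) (a b u : 'X_{1..n}).

Lemma mi_sup I a b : I 'X_[a] -> (a <= b)%MM -> I 'X_[b].
Proof. by move=> Ia ab; rewrite -(submK ab) mpolyXD; apply: miM. Qed.

Lemma mi_addX I J a : mi_add I J 'X_[a] <-> I 'X_[a] \/ J 'X_[a].
Proof.
split=> [[q [r [Iq Jr E]]]|[Ia|Ja]]; last 2 first.
- by exists 'X_[a], 0; split; rewrite ?addr0 //; apply: mi0.
- by exists 0, 'X_[a]; split; rewrite ?add0r //; apply: mi0.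
have : a \in msupp (q + r) by rewrite -E msuppX inE.
move=> /msuppD_le; rewrite mem_cat => /orP[aq|ar].
  by left; move/monIdealP: Iq; apply.
by right; move/monIdealP: Jr; apply.
Qed.

Lemma mi_ofX (G : 'X_{1..n} -> Prop) a :
  mi_of K G 'X_[a] <-> exists2 g, G g & (g <= a)%MM.
Proof.
rewrite /= mon_spanP; split=> [|[g Gg ga] u]; first by apply; rewrite msuppX inE.
by rewrite msuppX inE => /eqP ->; exists g.
Qed.

Lemma mi_big_addX I r (F : 'I_r -> monIdeal K n) a :
  (\big[@mi_add K n/I]_(i < r) F i) 'X_[a] <-> I 'X_[a] \/ exists i, F i 'X_[a].
Proof.
suff H (s : seq 'I_r) : (\big[@mi_add K n/I]_(i <- s) F i) 'X_[a] <->
    I 'X_[a] \/ exists2 i, i \in s & F i 'X_[a].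
  rewrite H; split=> -[|[i]]; [by left|by right; exists i|by left|].
  by right; exists i => //; rewrite mem_index_enum.
elim: s => [|j s IH]; first by rewrite big_nil; split=> [|[|[]]] //; left.
rewrite big_cons mi_addX IH; split=> [[Fa|[Ia|[i si Fa]]]|[Ia|[i]]].
- by right; exists j => //; rewrite mem_head.
- by left.
- by right; exists i => //; rewrite inE si orbT.
- by right; left.
by rewrite inE => /orP[/eqP ->|si Fa]; [left|right; right; exists i].
Qed.

Lemma min_generator_exists I a :
  I 'X_[a] -> exists2 g, min_generator I g & (g <= a)%MM.
Proof.
elim: {a}(mdeg a) {-2}a (leqnn (mdeg a)) => [|k IH] a ak Ia;
  have [amin|] := EM (min_generator I a);
  try by exists a => //; apply: lepm_refl.
- move=> []; split=> // w _ wa; have := ak; rewrite leqn0 mdeg_eq0 => /eqP a0.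
  by apply/mnmP => v; have /mnm_lepP/(_ v) := wa; rewrite a0 mnm0E; lia.
move=> nmin; have [w [Iw wa wna]] : exists w, [/\ I 'X_[w], (w <= a)%MM & w != a].
  apply: contrapT => no; apply: nmin; split=> // w Iw wa.
  by apply/eqP/negPn/negP => wna; apply: no; exists w.
have wk : (mdeg w <= k)%N.
  have E := submK wa; have : (0 < mdeg (a - w))%N.
    rewrite lt0n mdeg_eq0; apply: contraNneq wna => E0.
    by rewrite -E E0 add0m.
  by move: ak; rewrite -{1}E mdegD; lia.
have [g gmin gw] := IH _ wk Iw; exists g => //; exact: lepm_trans gw wa.
Qed.

End MonomialsOfIdeals.

Section ColoredIdeals.
Variables (K : fieldType) (d : nat) (m : 'I_d -> nat).
Local Notation n := (nvars m).
Variables (I : monIdeal K n) (hI : color_sqfree_ideal I).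
Implicit Types (a b u : 'X_{1..n}) (v w : 'I_n).

Lemma varE v : v = @var d m (color v) (tagnat.sig2 v).
Proof. by rewrite /var /color tagnat.sig2K. Qed.

Lemma var_of_color v i : color v = i -> exists j, v = @var d m i j.
Proof. by move=> <-; exists (tagnat.sig2 v); apply: varE. Qed.

Lemma var_inj i (j k : 'I_(m i)) : (j < k)%N -> var j != var k.
Proof.
apply: contraTneq => /(congr1 val)/eqP; rewrite tagnat.eq_Rank eqxx /= => /eqP ->.
by rewrite ltnn.
Qed.

Lemma lem_U2 v w a : (U_(v) + U_(w) <= a)%MM = ((v == w).+1 <= a v)%N && (0 < a w)%N.
Proof.
apply/mnm_lepP/andP => [H|[Hv Hw] x].
  have := H v; have := H w; rewrite !mnmDE !mnm1E !eqxx eq_sym.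
  by case: eqP => _ /=; lia.
rewrite mnmDE !mnm1E; case: eqP => [<-|_]; first by rewrite eq_sym.
by case: eqP => [<-|_].
Qed.

Lemma m_br2X i a : @m_br2 K d m i 'X_[a] <->
  exists j k : 'I_(m i), [/\ (j < k)%N, 0 < a (var j) & 0 < a (var k)]%N.
Proof.
rewrite mi_ofX; split=> [[_ [j [k [jk ->]]]]|[j [k [jk aj ak]]]].
  by rewrite lem_U2 (negPf (var_inj jk)) => /andP[aj ak]; exists j, k.
exists (U_(var j) + U_(var k))%MM; first by exists j, k.
by rewrite lem_U2 (negPf (var_inj jk)) aj.
Qed.

Lemma m_X i a : @m_ K d m i 'X_[a] <-> exists j : 'I_(m i), (U_(var j) <= a)%MM.
Proof.
rewrite mi_ofX; split=> [[_ [j ->] ja]|[j ja]]; first by exists j.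
by exists U_(var j)%MM; first by exists j.
Qed.

Lemma m_sqX i a : @m_sq K d m i 'X_[a] <->
  exists j k : 'I_(m i), (U_(var j) + U_(var k) <= a)%MM.
Proof.
rewrite mi_ofX; split=> [[_ [g [h [/m_X[j jg] /m_X[k kh] ->]]] gha]|[j [k jka]]].
  exists j, k; apply: lepm_trans gha; apply/mnm_lepP => v; rewrite !mnmDE.
  by apply: leq_add; apply/mnm_lepP.
exists (U_(var j) + U_(var k))%MM => //; exists U_(var j)%MM, U_(var k)%MM.
by split=> //; apply/m_X; [exists j|exists k]; apply: lepm_refl.
Qed.

(** The minimal generators of [I'] are squarefree: those of [I] by hypothesis,
    and the products of two distinct variables of one color. *)
Lemma add_br2_supp a b : add_br2 I 'X_[a] ->
  (forall v, 0 < a v -> 0 < b v)%N -> add_br2 I 'X_[b].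
Proof.
rewrite !mi_big_addX => Ia ab; case: Ia => [Ia|[i /m_br2X[j [k [jk aj ak]]]]].
  left; have [g gmin ga] := min_generator_exists Ia; apply: mi_sup gmin.1 _.
  have /andP[/forallP gs _] := hI gmin; apply/mnm_lepP => v.
  have := gs v; have := ab v; have /mnm_lepP/(_ v) := ga; lia.
by right; exists i; apply/m_br2X; exists j, k; split=> //; apply: ab.
Qed.

Lemma add_br2_not_color_sqfree u : sqfree u -> ~~ color_sqfree u -> add_br2 I 'X_[u].
Proof.
rewrite /color_sqfree => -> /forallPn[v /forallPn[w]]; rewrite negb_imply.
move=> /andP[/and3P[uv uw /eqP vw] vnw]; apply/mi_big_addX; right.
have [i iv] : exists i, color v = i by exists (color v).
exists i; have [j Ev] := var_of_color iv; rewrite iv in vw.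
have [k Ew] := var_of_color (esym vw); rewrite Ev Ew in uv uw vnw.
apply/m_br2X; have [jk|kj|/val_inj E] := ltngtP j k.
- by exists j, k.
- by exists k, j.
by rewrite E eqxx in vnw.
Qed.

Lemma add_br2_sq a : add_br2 I 'X_[a] -> add_sq I 'X_[a].
Proof.
rewrite !mi_big_addX => -[Ia|[i /m_br2X[j [k [jk aj ak]]]]]; first by left.
by right; exists i; apply/m_sqX; exists j, k; rewrite lem_U2 (negPf (var_inj jk)) aj.
Qed.

Lemma add_sq_sq a v : (1 < a v)%N -> add_sq I 'X_[a].
Proof.
move=> av; apply/mi_big_addX; right; exists (color v); apply/m_sqX.
by exists (tagnat.sig2 v), (tagnat.sig2 v); rewrite -varE lem_U2 eqxx av ltnW.
Qed.

(** Modulo [I'] the ideals [m_i^2] contribute exactly the squares of the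
    variables. *)
Lemma add_sqP a : add_sq I 'X_[a] -> add_br2 I 'X_[a] \/ exists v, (1 < a v)%N.
Proof.
rewrite !mi_big_addX => -[Ia|[i /m_sqX[j [k]]]]; first by left; left.
rewrite lem_U2 => /andP[aj ak]; have [jk|kj|E] := ltngtP j k.
- left; right; exists i; apply/m_br2X; exists j, k; split=> //.
  by move: aj; rewrite (negPf (var_inj jk)).
- left; right; exists i; apply/m_br2X; exists k, j; split=> //.
  by move: aj; rewrite eq_sym (negPf (var_inj kj)).
by right; exists (var j); move: aj; rewrite (val_inj E) eqxx.
Qed.

Lemma sqfree_mdeg u : sqfree u -> mdeg u = #|[set v | 0 < u v]%N|.
Proof.
move=> /forallP us; rewrite mdegE -sum1_card [RHS]big_mkcond /=; apply: eq_bigr => v _.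
by rewrite inE; have := us v; case: (u v) => [|[]].
Qed.

(** At most one variable of each color occurs. *)
Lemma color_sqfree_mdeg u : color_sqfree u -> (mdeg u <= d)%N.
Proof.
move=> /andP[us /forallP uc]; rewrite (sqfree_mdeg us).
rewrite -[d in (_ <= d)%N]card_ord -(card_in_imset (f := @color d m)).
  exact: max_card.
move=> v w; rewrite !inE => uv uw vw.
by have /forallP/(_ w)/implyP := uc v; rewrite uv uw vw eqxx => /(_ isT)/eqP.
Qed.

End ColoredIdeals.

(** * The Koszul complex of the squares *)

Section MonOfDeg.
Variables (d : nat) (m : 'I_d -> nat).
Local Notation n := (nvars m).

Lemma mon_val_inj (Q : pred 'X_{1..n}) k : injective (@mon_val d m Q k).
Proof. by move=> u u' uu; do 2!apply: val_inj. Qed.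

Lemma mon_of_degP (Q : pred 'X_{1..n}) k (u : mon_of_deg Q k) : Q u && (mdeg u == k).
Proof. exact: (valP u). Qed.

Lemma mon_of_deg_exists (Q : pred 'X_{1..n}) (k : nat) (u : 'X_{1..n}) :
  Q u -> mdeg u = k -> exists u' : mon_of_deg Q k, mon_val u' = u.
Proof.
move=> Qu uk; have ub : (mdeg u < k.+1)%N by rewrite uk.
have Qu' : Q (BMultinom ub) && (mdeg (BMultinom ub) == k) by rewrite /= Qu uk eqxx.
by exists (exist _ (BMultinom ub) Qu').
Qed.

Lemma sqfree_add u v : @sqfree d m (u + U_(v))%MM = sqfree u && (u v == 0%N).
Proof.
apply/forallP/andP => [H|[/forallP H /eqP uv] w].
  split; first by apply/forallP => w; have := H w; rewrite mnmDE; lia.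
  by have := H v; rewrite mnmDE mnm1E eqxx; lia.
by rewrite mnmDE mnm1E; have := H w; case: eqP => [<-|_]; rewrite ?uv ?addn0.
Qed.

End MonOfDeg.

Section Koszul.
Variables (K : fieldType) (d : nat) (m : 'I_d -> nat).
Local Notation n := (nvars m).
Local Notation P := {mpoly K[n]}.
Implicit Types (a b u w : 'X_{1..n}) (v x : 'I_n).

(** Extending the coefficients by zero to all monomials turns the sums over
    squarefree monomials in the differential into sums over the variables. *)
Definition kcoef k (z : koszul K m k) u : P := \sum_(u' | mon_val u' == u) z u'.

Lemma kcoefE k (z : koszul K m k) (u : mon_of_deg _ k) : kcoef z u = z u.
Proof.
by rewrite /kcoef (big_pred1 u) // => u'; rewrite /= (inj_eq (@mon_val_inj _ _ _ _)).
Qed.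

Lemma kcoef_dflt k (z : koszul K m k) u :
  ~~ (sqfree u && (mdeg u == k)) -> kcoef z u = 0.
Proof.
move=> uk; rewrite /kcoef big1 // => u' /eqP uu.
by move: (mon_of_degP u') uk; rewrite uu => ->.
Qed.

(** The exponent of the Koszul sign of [e_(u+v) |-> x_v^2 e_u]. *)
Definition ksgn u v : nat := \sum_(w < n | (w < v)%N) u w.

Lemma ksgnD u v x : ksgn (u + U_(x)) v = (ksgn u v + (x < v))%N.
Proof.
rewrite /ksgn; under eq_bigr => w _ do rewrite mnmDE.
rewrite big_split /=; congr (_ + _)%N; case: (boolP (x < v)%N) => xv.
  rewrite (bigD1 x) //= mnm1E eqxx big1 // => w /andP[_ /negPf wx].
  by rewrite mnm1E eq_sym wx.
rewrite big1 // => w wv; rewrite mnm1E; case: eqP wv => // <-.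
by rewrite (negPf xv).
Qed.

Lemma koszul_dE k (z : koszul K m k.+1) (u : mon_of_deg (@sqfree d m) k) :
  koszul_d z u = \sum_v kcoef z (u + U_(v)) * (-1) ^+ ksgn u v * 'X_v ^+ 2.
Proof.
rewrite ffunE (exchange_big_dep predT) //=; apply: eq_bigr => v _.
rewrite /kcoef !mulr_suml; apply: eq_bigr => u' E.
have -> : koszul_sign K (mon_val u') v = (-1) ^+ ksgn (mon_val u') v by [].
by rewrite (eqP E) ksgnD ltnn addn0.
Qed.

Lemma kcoef_d k (z : koszul K m k.+1) u :
  kcoef (koszul_d z) u = \sum_v kcoef z (u + U_(v)) * (-1) ^+ ksgn u v * 'X_v ^+ 2.
Proof.
have [/andP[us /eqP uk]|no] := boolP (sqfree u && (mdeg u == k)).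
  by have [u' <-] := mon_of_deg_exists us uk; rewrite kcoefE koszul_dE.
rewrite kcoef_dflt // big1 // => v _; rewrite kcoef_dflt ?mul0r //.
apply: contra no; rewrite sqfree_add mdegD mdeg1 addn1 eqSS.
by move=> /andP[/andP[-> _] ->].
Qed.

(** The terms for the removal of [x] then [v] and of [v] then [x] cancel.  The
    terms with [x = v] vanish separately, which matters in characteristic
    two. *)
Lemma koszul_dd k (z : koszul K m k.+2) : koszul_d (koszul_d z) = [ffun=> 0].
Proof.
apply/ffunP => u; rewrite koszul_dE ffunE; move: (mon_val u) => {}u.
pose T v x := kcoef z (u + U_(v) + U_(x)) * (-1) ^+ ksgn (u + U_(v)) x * 'X_x ^+ 2
  * (-1) ^+ ksgn u v * 'X_v ^+ 2.
have Tvv v : T v v = 0.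
  rewrite /T kcoef_dflt ?mul0r // sqfree_add mnmDE mnm1E eqxx addn1.
  by rewrite andbF.
have Tvx v x : (v < x)%N -> T x v = - T v x.
  move=> vx; rewrite /T !ksgnD vx ltnNge ltnW //= addn0 addn1 -!addmA.
  rewrite [(U_(x) + U_(v))%MM]addmC [(-1) ^+ (ksgn u x).+1]exprS.
  by move: (kcoef z _) ((-1) ^+ _) ((-1) ^+ _) => p q r; ring.
transitivity (\sum_(v < n) \sum_(x < n) T v x).
  by apply: eq_bigr => v _; rewrite kcoef_d !mulr_suml.
have -> : \sum_(v < n) \sum_(x < n) T v x =
    \sum_(v < n) (\sum_(x < n | (v < x)%N) T v x + \sum_(x < n | (x < v)%N) T v x).
  apply: eq_bigr => v _; rewrite (bigID (fun x : 'I_n => v < x)%N) /=; congr (_ + _).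
  rewrite (bigD1 v) ?ltnn //= Tvv add0r; apply: eq_bigl => x.
  by rewrite -leqNgt ltn_neqAle andbC.
rewrite big_split /= [X in _ + X](exchange_big_dep predT) //= -big_split /= big1 //.
move=> v _; rewrite -big_split /= big1 // => x vx.
by rewrite (Tvx _ _ vx) subrr.
Qed.

End Koszul.

(** * Exactness in each fine degree *)

Section Contraction.
Variables (K : fieldType) (d : nat) (m : 'I_d -> nat).
Local Notation n := (nvars m).
Local Notation P := {mpoly K[n]}.
Implicit Types (a b u w : 'X_{1..n}) (v x : 'I_n) (c : 'X_{1..n} -> K).

(** The elements of degree [a] of the Koszul complex correspond to scalar
    functions [c] on the squarefree [u] with [2 deg u <= a]. *)
Definition kelt k a c : koszul K m k :=
  [ffun u : mon_of_deg _ k => if (u + u <= a)%MM then c u *: 'X_[a - (u + u)] else 0].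

(** In degree [a] the Koszul complex of the squares is the chain complex of the
    simplex on the variables of exponent at least two in [a]. *)
Definition bd a c u : K :=
  \sum_(v | (u v == 0%N) && (1 < a v)%N) ((-1) ^+ ksgn u v * c (u + U_(v))%MM).

Lemma kcoef_kelt k a c u : kcoef (kelt k a c) u =
  if [&& sqfree u, mdeg u == k & (u + u <= a)%MM] then c u *: 'X_[a - (u + u)] else 0.
Proof.
have [/andP[us /eqP uk]|no] := boolP (sqfree u && (mdeg u == k)).
  have [u' E] := mon_of_deg_exists us uk.
  by rewrite -E kcoefE ffunE E us uk eqxx.
by rewrite kcoef_dflt // andbA (negPf no).
Qed.

Lemma koszul_d_kelt k a c : koszul_d (kelt k.+1 a c) = kelt k a (bd a c).
Proof.
apply/ffunP => u; rewrite koszul_dE ffunE.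
have /andP[us uk] := mon_of_degP u; move: (mon_val u) us uk => {}u us uk.
have E v : kcoef (kelt k.+1 a c) (u + U_(v)) =
    if (u v == 0%N) && (u + U_(v) + (u + U_(v)) <= a)%MM
    then c (u + U_(v))%MM *: 'X_[a - (u + U_(v) + (u + U_(v)))] else 0.
  by rewrite kcoef_kelt sqfree_add us mdegD mdeg1 addn1 eqSS uk.
under eq_bigr => v _ do rewrite E.
have [ua|nua] := boolP (u + u <= a)%MM; last first.
  rewrite big1 // => v _; case: ifP; rewrite ?mul0r // => /andP[_ uva].
  case/negP: nua; apply: lepm_trans uva; apply/mnm_lepP => x; rewrite !mnmDE.
  by lia.
rewrite /bd scaler_suml big_mkcond [RHS]big_mkcond; apply: eq_bigr => v _ /=.
have uv : (u v == 0%N) && (u + U_(v) + (u + U_(v)) <= a)%MM =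
    (u v == 0%N) && (1 < a v)%N.
  case: eqP => //= uv; apply/mnm_lepP/idP => [/(_ v)|av x].
    by rewrite !mnmDE mnm1E eqxx uv.
  have /mnm_lepP/(_ x) := ua; rewrite !mnmDE mnm1E.
  by case: eqP => [<-|_]; rewrite ?uv; lia.
rewrite uv; case: ifP => [/andP[/eqP uv0 av]|]; last by rewrite !mul0r.
have -> : 'X_[a - (u + u)] = 'X_[a - (u + U_(v) + (u + U_(v)))] * 'X_v ^+ 2 :> P.
  rewrite mpolyXn -mpolyXD; congr 'X_[_]; apply/mnmP => x.
  rewrite mnmDE mulmnE !mnmBE !mnmDE mnm1E; have /mnm_lepP/(_ x) := ua; rewrite mnmDE.
  by case: eqP => [<-|_]; rewrite ?uv0; lia.
rewrite -!scalerAl; move: ('X_[_]) => p.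
rewrite -scalerA mulrAC -[(-1) ^+ _ in LHS]signr_odd -[(-1) ^+ _ in RHS]signr_odd.
by case: odd; rewrite ?expr0 ?expr1 ?mulr1 ?scale1r // mulrN1 scaleN1r scalerN.
Qed.

(** The cone with vertex [v] over the simplex. *)
Definition contract v c u : K := if (0 < u v)%N then c (u - U_(v))%MM else 0.

(** With [v0] the first vertex, adding it to a face has sign one, and commuting it
    past another vertex contributes the sign that makes the remaining terms of
    [bd (contract c)] and [contract (bd c)] cancel. *)
Lemma bd_contract a v0 c u :
    (1 < a v0)%N -> (forall v, v < v0 -> a v <= 1)%N -> sqfree u -> (u + u <= a)%MM ->
    (forall w, u = (w + U_(v0))%MM -> bd a c w = 0) ->
  bd a (contract v0 c) u = c u.
Proof.
move=> av0 min /forallP us /mnm_lepP ua cyc.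
have ksgn0 w : (w <= u)%MM -> ksgn w v0 = 0%N.
  move=> /mnm_lepP wu; rewrite /ksgn big1 // => v vv0.
  by have := min _ vv0; have := ua v; have := wu v; rewrite mnmDE; lia.
have [uv0|uv0] := posnP (u v0).
  rewrite /bd (bigD1 v0) /=; last by rewrite uv0.
  rewrite ksgn0 ?lepm_refl // mul1r /contract mnmDE mnm1E eqxx addn1 /= addmK.
  rewrite big1 ?addr0 // => v /andP[_ /negPf vv0].
  by rewrite mnmDE mnm1E vv0 uv0 mulr0.
have [w Ew] : exists w, u = (w + U_(v0))%MM.
  exists (u - U_(v0))%MM; rewrite submK //; apply/mnm_lepP => v.
  by rewrite mnm1E; case: eqP => // <-.
have wv0 : w v0 = 0%N by have := us v0; rewrite Ew mnmDE mnm1E eqxx; lia.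
have := cyc w Ew; rewrite /bd (bigD1 v0) /= ?wv0 //.
rewrite ksgn0; last by rewrite Ew; apply: lem_addr.
rewrite mul1r -Ew => /eqP; rewrite addr_eq0 => /eqP ->; rewrite -sumrN.
apply: eq_big => v.
  by rewrite Ew mnmDE mnm1E addn_eq0 eqb0 [v0 == v]eq_sym -!andbA [(_ != _) && _]andbC.
move=> /andP[/eqP uv av].
have vv0 : v0 != v by apply: contraTneq uv0 => ->; rewrite uv.
have v0v : (v0 < v)%N.
  rewrite ltn_neqAle vv0 leqNgt; apply/negP => /min; lia.
have Ec : (u + U_(v))%MM = (w + U_(v) + U_(v0))%MM.
  by rewrite Ew -!addmA [(U_(v0) + _)%MM]addmC.
rewrite /contract Ec addmK mnmDE mnm1E eqxx addn1 /=.
by rewrite Ew ksgnD v0v addn1 exprS mulN1r mulNr.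
Qed.

End Contraction.

(** * The exact sequence *)

(** The homogeneous components of a cycle are cycles, because their images lie
    in different degrees. *)
Lemma graded_exact (K : fieldType) (n : nat) (A B C : grModule K n)
    (f : {linear A -> B}) (g : {linear B -> C}) :
    gr_map g -> (forall a x, gm_hom a x -> g x = 0 -> exists y, x = f y) ->
  forall x, g x = 0 -> exists y, x = f y.
Proof.
move=> gh H x; have [s /(_ (undup s) (undup_uniq s))[e|h [hh ->]]] := gm_sum_on x.
  by rewrite mem_undup.
rewrite raddf_sum => g0.
have {}g0 a : a \in undup s -> g (h a) = 0.
  apply: (gm_indep (f := fun a => g (h a))) => //; first exact: undup_uniq.
  by move=> b; apply: gh.
elim: (undup s) g0 => [|a t IH] g0.
  by exists 0; rewrite big_nil raddf0.
have [|y Ey] := IH; first by move=> b bt; apply: g0; rewrite inE bt orbT.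
have [|y' Ey'] := H a (h a) (hh a); first by apply: g0; rewrite mem_head.
by exists (y' + y); rewrite big_cons Ey Ey' raddfD.
Qed.

Section ExactSequence.
Variables (K : fieldType) (d : nat) (m : 'I_d -> nat).
Local Notation n := (nvars m).
Local Notation P := {mpoly K[n]}.
Variables (I : monIdeal K n) (hI : color_sqfree_ideal I).
Implicit Types (v : 'I_n) (c : 'X_{1..n} -> K).

Local Notation I' := (add_br2 I).
Local Notation F k := (F_ I' k).
Local Notation proj := (koszul_proj I').

Definition fcoord k (x : F k) (u : mon_of_deg (@color_sqfree d m) k) :
    mquot (mi_colon I' u) :=
  (x : dsum_sort (fun u : mon_of_deg (@color_sqfree d m) k => F_summand I' u)) u.

Lemma fcoordP k (x y : F k) : (forall u, fcoord x u = fcoord y u) -> x = y.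
Proof. by move=> xy; apply/ffunP => u; apply: xy. Qed.

Lemma fcoordD k (x y : F k) u : fcoord (x + y) u = fcoord x u + fcoord y u.
Proof. exact: ffunE. Qed.

Lemma fcoordZ k p (x : F k) u : fcoord (p *: x) u = p *: fcoord x u.
Proof. exact: ffunE. Qed.

Lemma fcoord0 k u : fcoord (0 : F k) u = 0.
Proof. exact: ffunE. Qed.

Lemma fcoord_proj k (z : koszul K m k) u :
  fcoord (proj z) u = mclass (mi_colon I' u) (z (sqfree_of u)).
Proof. exact: ffunE. Qed.

Definition klin k p (z z' : koszul K m k) : koszul K m k := [ffun u => p * z u + z' u].

Lemma proj_lin k p (z z' : koszul K m k) : proj (klin p z z') = p *: proj z + proj z'.
Proof.
apply: fcoordP => u; rewrite fcoordD fcoordZ !fcoord_proj ffunE.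
by rewrite -[_ *: mclass _ _]/(mquot_scale _ _) mclassZ mclass_add.
Qed.

Lemma koszul_d_lin k p (z z' : koszul K m k.+1) :
  koszul_d (klin p z z') = klin p (koszul_d z) (koszul_d z').
Proof.
apply/ffunP => w; rewrite !ffunE mulr_sumr -big_split; apply: eq_bigr => u _ /=.
rewrite mulr_sumr -big_split; apply: eq_bigr => v _.
by rewrite ffunE /= !mulrDl !mulrA.
Qed.

Lemma mclass_eq0 (J : monIdeal K n) p : mclass J p = 0 <-> J p.
Proof. by rewrite -[p in J p]subr0; apply: mclassP. Qed.

(** The components at squarefree [u] that are not color-squarefree impose no
    condition, since such [u] lie in [I']. *)
Lemma proj_eq0 k (z : koszul K m k) :
  proj z = 0 <-> forall u, I' (z u * 'X_[mon_val u]).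
Proof.
split=> [z0 u|z0]; last first.
  by apply: fcoordP => u; rewrite fcoord_proj fcoord0; apply/mclass_eq0/z0.
have /andP[us uk] := mon_of_degP u.
have [uc|uc] := boolP (color_sqfree (mon_val u)); last first.
  exact/miM/add_br2_not_color_sqfree.
have [u' E] := mon_of_deg_exists uc (eqP uk).
have -> : u = sqfree_of u' by apply: mon_val_inj; rewrite -E.
have : fcoord (proj z) u' = 0 by rewrite z0 fcoord0.
by rewrite fcoord_proj => /mclass_eq0.
Qed.

Lemma proj_surj k a (x : F k) : exists z, proj z = x /\
  (gm_hom a x -> forall u, mhomog (a - deg_mon (mon_val u) *+ 2) (z u)).
Proof.
have /choice[z zP] (u : mon_of_deg (@sqfree d m) k) : exists p : P,
    (forall u', sqfree_of u' = u -> fcoord x u' = mclass _ p) /\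
    (gm_hom a x -> mhomog (a - deg_mon (mon_val u) *+ 2) p).
  have [[u' Eu]|no] := EM (exists u', sqfree_of u' = u); last first.
    exists 0; split=> [u' Eu|_]; last exact: mhomog0.
    by case: no; exists u'.
  have inj u'' : sqfree_of u'' = u -> u'' = u'.
    move=> E; apply: mon_val_inj.
    by rewrite -[mon_val _]/(mon_val (sqfree_of u'')) E -Eu.
  have [xa|xa] := EM (gm_hom a x); last first.
    have [p Ep] : exists p, fcoord x u' = mclass _ p.
      by elim/mquotW: (fcoord x u') => p; exists p.
    by exists p; split=> // u'' /inj ->.
  have [p ph Ep] := xa u'; exists p; split=> [u'' /inj -> //|_].
  by rewrite -Eu.
exists (finfun z); split=> [|xa u]; last by rewrite ffunE; have [_] := zP u; apply.
apply: fcoordP => u; rewrite fcoord_proj ffunE; have [zu _] := zP (sqfree_of u).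
by rewrite -zu.
Qed.

(** The term [x_v^2 e_w] of the differential of [e_(w+v)] satisfies
    [x_v^2 x^w = x_v x^(w+v)], so [I':(w+v)] is mapped into [I':w]. *)
Lemma proj_d0 k (z : koszul K m k.+1) : proj z = 0 -> proj (koszul_d z) = 0.
Proof.
move=> /proj_eq0 z0; apply/proj_eq0 => w; rewrite koszul_dE mulr_suml.
apply: big_ind => [||v _]; [exact: mi0|exact: miD|].
have -> : kcoef z (mon_val w + U_(v)) * (-1) ^+ ksgn (mon_val w) v * 'X_v ^+ 2 *
    'X_[mon_val w] = (-1) ^+ ksgn (mon_val w) v * 'X_v *
    (kcoef z (mon_val w + U_(v)) * 'X_[mon_val w + U_(v)]).
  rewrite mpolyXD; move: (kcoef _ _) ('X_[mon_val w]) ('X_v) ((-1) ^+ _) => p q r s.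
  by ring.
apply: miM; rewrite /kcoef mulr_suml; apply: big_ind => [||u /eqP <-].
- exact: mi0.
- exact: miD.
exact: z0.
Qed.

Definition klift k (x : F k) : koszul K m k := projT1 (cid (proj_surj 0 x)).

Lemma kliftK k (x : F k) : proj (klift x) = x.
Proof. by case: (projT2 (cid (proj_surj 0 x))). Qed.

Lemma proj_d_eq k (z z' : koszul K m k.+1) :
  proj z = proj z' -> proj (koszul_d z) = proj (koszul_d z').
Proof.
move=> zz; have /proj_d0 : proj (klin (-1) z' z) = 0.
  by rewrite proj_lin zz scaleN1r addNr.
rewrite koszul_d_lin proj_lin scaleN1r => /eqP; rewrite addrC subr_eq0 => /eqP //.
Qed.

Definition Fd k (x : F k.+1) : F k := proj (koszul_d (klift x)).

Lemma Fd_proj k (z : koszul K m k.+1) : Fd (proj z) = proj (koszul_d z).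
Proof. by apply: proj_d_eq; rewrite kliftK. Qed.

Lemma Fd_linear k : linear (@Fd k).
Proof.
move=> p x y; rewrite -[x]kliftK -[y]kliftK -proj_lin !Fd_proj koszul_d_lin.
by rewrite proj_lin.
Qed.
HB.instance Definition _ k :=
  GRing.isLinear.Build P (F k.+1) (F k) *:%R (@Fd k) (@Fd_linear k).

Lemma kcoef_homog k a (z : koszul K m k) :
    (forall u, mhomog (a - deg_mon (mon_val u) *+ 2) (z u)) ->
  forall u, mhomog (a - deg_mon u *+ 2) (kcoef z u).
Proof.
move=> za u; apply: (big_ind (mhomog _)) => [||u' /eqP <-]; last exact: za.
  exact: mhomog0.
exact: mhomogD.
Qed.

Lemma koszul_d_homog k a (z : koszul K m k.+1) :
    (forall u, mhomog (a - deg_mon (mon_val u) *+ 2) (z u)) ->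
  forall u, mhomog (a - deg_mon (mon_val u) *+ 2) (koszul_d z u).
Proof.
move=> za u; rewrite koszul_dE; apply: mhomog_sum => v.
have -> : a - deg_mon (mon_val u) *+ 2 =
    a - deg_mon (mon_val u + U_(v))%MM *+ 2 + deg_mon (U_(v) *+ 2)%MM.
  have -> : (U_(v) *+ 2 = U_(v) + U_(v))%MM.
    by rewrite mulmS mulm1n.
  have E (V : zmodType) (e x y : V) : e - x *+ 2 = e - (x + y) *+ 2 + (y + y).
    rewrite -[y + y]mulr2n mulrnDl; move: (x *+ 2) (y *+ 2) => {}x {}y.
    by rewrite opprD -addrA subrK.
  by rewrite !deg_monD; apply: E.
rewrite mpolyXn; apply: mhomogM (@mhomogX K n _).
rewrite -signr_odd; case: odd; rewrite ?expr0 ?expr1 ?mulr1 ?mulrN1.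
  by apply/mhomogN/kcoef_homog.
exact: kcoef_homog.
Qed.

Lemma proj_homog k a (z : koszul K m k) :
    (forall u, mhomog (a - deg_mon (mon_val u) *+ 2) (z u)) ->
  gm_hom a (proj z).
Proof.
move=> za u; exists (z (sqfree_of u)); last exact: (fcoord_proj z u).
exact: (za (sqfree_of u)).
Qed.

Lemma Fd_gr_map k : gr_map (@Fd k).
Proof.
move=> a x xa; have [z [zx /(_ xa) zh]] := proj_surj a x.
by rewrite -zx Fd_proj; apply/proj_homog/koszul_d_homog.
Qed.

Lemma color_sqfree0 : @color_sqfree d m 0%MM.
Proof.
apply/andP; split; first by apply/forallP => v; rewrite mnm0E.
by apply/forallP => v; apply/forallP => w; rewrite mnm0E.
Qed.

Definition mon0 : mon_of_deg (@color_sqfree d m) 0 :=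
  projT1 (cid (mon_of_deg_exists color_sqfree0 mdeg0)).

Lemma mon0E : mon_val mon0 = 0%MM.
Proof. exact: (projT2 (cid (mon_of_deg_exists color_sqfree0 mdeg0))). Qed.

Lemma mon_of_deg0 (Q : pred 'X_{1..n}) (u : mon_of_deg Q 0) : mon_val u = 0%MM.
Proof. by have /andP[_] := mon_of_degP u; rewrite mdeg_eq0 => /eqP. Qed.

Definition Faug (x : F 0) : gm_quot (add_sq I) :=
  mclass (add_sq I) (klift x (sqfree_of mon0)).

Lemma Faug_proj (z : koszul K m 0) :
  Faug (proj z) = mclass (add_sq I) (z (sqfree_of mon0)).
Proof.
apply/mclassP.
have : proj (klin (-1) z (klift (proj z))) = 0.
  by rewrite proj_lin kliftK scaleN1r addNr.
move=> /proj_eq0/(_ (sqfree_of mon0)).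
rewrite -[mon_val (sqfree_of mon0)]/(mon_val mon0) mon0E mpolyX0 mulr1 ffunE mulN1r.
rewrite addrC.
by move=> /monIdealP H; apply/monIdealP => w /H; apply: add_br2_sq.
Qed.

Lemma Faug_linear : linear Faug.
Proof.
move=> p x y; rewrite -[x]kliftK -[y]kliftK -proj_lin !Faug_proj ffunE.
by rewrite -[_ *: mclass _ _]/(mquot_scale _ _) mclassZ mclass_add.
Qed.
HB.instance Definition _ :=
  GRing.isLinear.Build P (F 0) (gm_quot (add_sq I)) *:%R Faug Faug_linear.

Lemma Faug_gr_map : gr_map Faug.
Proof.
move=> a x xa; have [z [zx /(_ xa) zh]] := proj_surj a x.
rewrite -zx Faug_proj; exists (z (sqfree_of mon0)) => //.
have := zh (sqfree_of mon0).
by rewrite -[mon_val (sqfree_of mon0)]/(mon_val mon0) mon0E deg_mon0 mul0rn subr0.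
Qed.

Lemma Faug_surj y : exists x, y = Faug x.
Proof.
elim/mquotW: y => p; exists (proj [ffun=> p]).
by rewrite Faug_proj ffunE.
Qed.

Lemma proj0 k : proj [ffun=> 0 : P] = 0 :> F k.
Proof. by apply/proj_eq0 => u; rewrite ffunE mul0r; apply: mi0. Qed.

Lemma Fd_Fd k (x : F k.+2) : Fd (Fd x) = 0.
Proof. by rewrite -[x]kliftK !Fd_proj koszul_dd proj0. Qed.

Lemma Faug_Fd (x : F 1) : Faug (Fd x) = 0.
Proof.
rewrite -[x]kliftK Fd_proj Faug_proj koszul_dE; apply/mclass_eq0.
apply: big_ind => [||v _]; [exact: mi0|exact: miD|].
apply: miM; rewrite mpolyXn; apply: (@add_sq_sq K d m I _ v).
by rewrite mulmnE mnm1E eqxx.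
Qed.

(** The possibility [z = 0] covers the degrees with a negative coordinate. *)
Lemma homog_kelt k (e : zdeg n) (z : koszul K m k) :
    (forall u, mhomog (e - deg_mon (mon_val u) *+ 2) (z u)) ->
  z = [ffun=> 0] \/ exists a c, e = deg_mon a /\ z = kelt k a c.
Proof.
move=> zh.
have zE u : z u != 0 -> exists w, z u = (z u)@_w *: 'X_[w] /\
    e = deg_mon (w + (mon_val u + mon_val u))%MM.
  rewrite -msupp_eq0; case E: (msupp _) => [//|w s] _; exists w.
  have [|Ew zu] := mhomog_coef (zh u) (u := w).
    by rewrite -mcoeff_msupp E mem_head.
  by split=> //; rewrite !deg_monD Ew -mulr2n subrK.
have [[u0 /zE[w0 [_ e0]]]|no] := EM (exists u, z u != 0); last first.
  left; apply/ffunP => u; rewrite ffunE; apply/eqP/negPn/negP => zu.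
  by apply: no; exists u.
right; set a := (w0 + _)%MM in e0.
exists a, (fun u => (kcoef z u)@_(a - (u + u))); split=> //.
apply/ffunP => u; rewrite ffunE kcoefE.
have [z0|/zE[w [zw ew]]] := eqVneq (z u) 0.
  by rewrite z0 mcoeff0 scale0r if_same.
have -> : a = (w + (mon_val u + mon_val u))%MM by apply: deg_mon_inj; rewrite -e0 ew.
by rewrite lem_addl addmK -zw.
Qed.

Lemma mi_term (J : monIdeal K n) (e : K) a : J (e *: 'X_[a]) -> e = 0 \/ J 'X_[a].
Proof.
move=> /monIdealP J1; have [->|e0] := eqVneq e 0; [by left|right].
by apply: J1; rewrite mcoeff_msupp mcoeffZ mcoeffX eqxx mulr1.
Qed.

(** Subtracting [deg u] does not change the support of [a] when
    [2 deg u <= a]. *)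
Lemma proj_kelt0 k a c : I' 'X_[a] -> proj (kelt k a c) = 0.
Proof.
move=> Ia; apply/proj_eq0 => u; rewrite ffunE; case: ifP => [/mnm_lepP ua|_]; last first.
  by rewrite mul0r; apply: mi0.
rewrite -scalerAl -mpolyXD -mul_mpolyC; apply: miM.
apply: (add_br2_supp hI Ia) => v av; rewrite mnmDE mnmBE mnmDE.
by have := ua v; rewrite mnmDE; lia.
Qed.

Lemma proj_kelt_eq0 k a c : ~ I' 'X_[a] -> proj (kelt k a c) = 0 ->
  forall u, sqfree u -> mdeg u = k -> (u + u <= a)%MM -> c u = 0.
Proof.
move=> nIa /proj_eq0 z0 u us uk ua.
have [u' E] := mon_of_deg_exists us uk; have := z0 u'; rewrite ffunE E ua.
rewrite -scalerAl -mpolyXD => /mi_term[//|Iau]; case: nIa.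
apply: (add_br2_supp hI Iau) => v; rewrite mnmDE mnmBE mnmDE.
by have /mnm_lepP/(_ v) := ua; rewrite mnmDE; lia.
Qed.

Lemma kelt_boundary k (a : 'X_{1..n}) c : (exists v, 1 < a v)%N ->
    (forall w, sqfree w -> (mdeg w).+1 = k -> (w + w <= a)%MM -> bd a c w = 0) ->
  exists z, kelt k a c = koszul_d z.
Proof.
move=> [v av] cyc.
have [v0 av0 min] := @arg_minnP _ v (fun v => 1 < a v)%N (fun v => nat_of_ord v) av.
exists (kelt k.+1 a (contract v0 c)); rewrite koszul_d_kelt.
apply/ffunP => u; rewrite !ffunE; case: ifP => // ua; congr (_ *: _).
have /andP[us /eqP uk] := mon_of_degP u; apply/esym/bd_contract => //.
  by move=> w wv0; rewrite leqNgt; apply/negP => /min; lia.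
move=> w uw; apply: cyc.
- by move: us; rewrite uw sqfree_add => /andP[].
- by rewrite -uk uw mdegD mdeg1 addn1.
apply: lepm_trans ua; rewrite uw; apply/mnm_lepP => x; rewrite !mnmDE; lia.
Qed.

Lemma Fd_exact k (x : F k.+1) : Fd x = 0 <-> exists y, x = Fd y.
Proof.
split=> [|[y ->]]; last exact: Fd_Fd.
apply: (@graded_exact _ _ _ _ _ (@Fd k.+1) (@Fd k)); first exact: Fd_gr_map.
move=> e {}x xe; have [z [zx /(_ xe) zh]] := proj_surj e x.
rewrite -{x xe}zx.
have triv : proj z = 0 -> exists y, proj z = Fd y by exists 0; rewrite raddf0.
have [->|[a [c [ea Ez]]]] := homog_kelt zh; first by exists 0; rewrite proj0 raddf0.
rewrite /= Fd_proj {}Ez koszul_d_kelt in triv *.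
have [Ia|nIa] := EM (I' 'X_[a]); first by move=> _; apply/triv/proj_kelt0.
move=> /(proj_kelt_eq0 nIa) cyc.
have [av|nav] := EM (exists v, 1 < a v)%N.
  have [|y ->] := @kelt_boundary k.+1 a c av; last by exists (proj y); rewrite -Fd_proj.
  by move=> w ws [wk] wa; apply: cyc.
(* Without variables of exponent two, degree [a] has no elements for [k > 0]. *)
apply: triv; apply/proj_eq0 => u; rewrite ffunE ifN ?mul0r; first exact: mi0.
apply/negP => /mnm_lepP ua; have /andP[_ /eqP uk] := mon_of_degP u.
have /eqP : mdeg (mon_val u) != 0%N by rewrite uk.
case; apply/eqP; rewrite mdeg_eq0; apply/eqP/mnmP => v; rewrite mnm0E.
apply/eqP/negPn/negP; rewrite -lt0n => uv; apply: nav; exists v.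
by have := ua v; rewrite mnmDE; lia.
Qed.

Lemma Faug_exact (x : F 0) : Faug x = 0 <-> exists y, x = Fd y.
Proof.
split=> [|[y ->]]; last exact: Faug_Fd.
apply: (@graded_exact _ _ _ _ _ (@Fd 0) Faug); first exact: Faug_gr_map.
move=> e {}x xe; have [z [zx /(_ xe) zh]] := proj_surj e x.
rewrite -{x xe}zx.
have triv : proj z = 0 -> exists y, proj z = Fd y by exists 0; rewrite raddf0.
have [->|[a [c [ea Ez]]]] := homog_kelt zh; first by exists 0; rewrite proj0 raddf0.
rewrite /= Faug_proj {}Ez ffunE in triv *.
rewrite -[mon_val (sqfree_of mon0)]/(mon_val mon0) mon0E addm0.
have -> : (0 <= a)%MM by apply/mnm_lepP => v; rewrite mnm0E.
rewrite subm0 => /mclass_eq0/mi_term[c0|/add_sqP[Ia|av]].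
- apply: triv; apply/proj_eq0 => u; rewrite ffunE mon_of_deg0 c0 scale0r if_same mul0r.
  exact: mi0.
- exact/triv/proj_kelt0.
by have [|y ->] := @kelt_boundary 0 a c av; last by exists (proj y); rewrite -Fd_proj.
Qed.

Lemma F_trivial (x : F d.+1) : x = 0.
Proof.
apply: fcoordP => u; have /andP[uc /eqP ud] := mon_of_degP u.
by have := color_sqfree_mdeg uc; rewrite ud ltnn.
Qed.

Definition Fiota (x : gm_quot I') : F 0 := proj [ffun=> repr (x : mquot I')].

Lemma Fiota_class p : Fiota (mclass I' p) = proj [ffun=> p].
Proof.
apply: fcoordP => u; rewrite !fcoord_proj !ffunE; apply/mclassP => /=.
rewrite mon_of_deg0 mpolyX0 mulr1 -opprB; apply/miN/mclass_repr.
Qed.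

Lemma Fiota_linear : linear Fiota.
Proof.
move=> p; elim/mquotW => q; elim/mquotW => r.
rewrite -[_ *: mclass _ _]/(mquot_scale _ _) mclassZ mclass_add !Fiota_class -proj_lin.
by congr proj; apply/ffunP => u; rewrite !ffunE.
Qed.
HB.instance Definition _ :=
  GRing.isLinear.Build P (gm_quot I') (F 0) *:%R Fiota Fiota_linear.

Lemma Fiota_bij : bijective Fiota.
Proof.
exists (fun x => mclass I' (klift x (sqfree_of mon0))) => [x|x].
  rewrite -[x]mclassK Fiota_class; set p := repr _; apply/mclassP.
  have : proj (klin (-1) [ffun=> p] (klift (proj [ffun=> p]))) = 0 :> F 0.
    by rewrite proj_lin kliftK scaleN1r addNr.
  move=> /proj_eq0/(_ (sqfree_of mon0)).
  rewrite -[mon_val (sqfree_of mon0)]/(mon_val mon0) mon0E mpolyX0 mulr1 !ffunE.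
  by rewrite mulN1r addrC.
rewrite Fiota_class -[RHS]kliftK; congr proj; apply/ffunP => u; rewrite ffunE.
by congr (klift x _); apply: mon_val_inj; rewrite !mon_of_deg0.
Qed.

Lemma Fiota_gr_map : gr_map Fiota.
Proof.
move=> a _ [p pa ->]; rewrite Fiota_class; apply: proj_homog => u.
by rewrite ffunE mon_of_deg0 deg_mon0 mul0rn subr0.
Qed.

End ExactSequence.

(** * Resolutions of the terms of the sequence *)

Lemma betti_ncells (K : fieldType) (n : nat) (M : grModule K n) C
    (g : 'I_(fc_rk C 0) -> M) (k : int) a :
  minimal_free_resolution g -> betti M k a = ncells C k a.
Proof.
case: k => // k [gR gmin].
by rewrite (betti_resolution _ _ gR) (hdim_minimal _ _ gmin).
Qed.

Section Terms.
Variables (K : fieldType) (d : nat) (m : 'I_d -> nat).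
Local Notation n := (nvars m).
Local Notation P := {mpoly K[n]}.
Variables (I : monIdeal K n) (hI : color_sqfree_ideal I).
Local Notation I' := (add_br2 I).

Definition off_supp (u : 'X_{1..n}) : 'X_{1..n} := [multinom (u v == 0%N : nat) | v < n].

(** The variables of [u] do not affect membership in [I':u], and the others only
    through their presence. *)
Lemma colon_resolution_exists (u : 'X_{1..n}) :
  exists C (g : 'I_(fc_rk C 0) -> gm_quot (mi_colon I' u)), minimal_free_resolution g /\
    forall k (i : 'I_(fc_rk C k)), exists2 s, (s <= off_supp u)%MM & fc_deg i = deg_mon s.
Proof.
apply: minimal_resolution_exists => w c /=; rewrite -!mpolyXD => Iwcu wc.
apply: (add_br2_supp hI Iwcu) => v; rewrite !mnmDE.
by have := wc v; rewrite mnmE; case: eqP => [->|]; lia.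
Qed.

Definition colon_res (u : 'X_{1..n}) : fcomplex K n :=
  projT1 (cid (colon_resolution_exists u)).

Lemma colon_resP (u : 'X_{1..n}) :
  exists g : 'I_(fc_rk (colon_res u) 0) -> gm_quot (mi_colon I' u),
    minimal_free_resolution g.
Proof. by have [g [gmin _]] := projT2 (cid (colon_resolution_exists u)); exists g. Qed.

Lemma colon_res_deg (u : 'X_{1..n}) k (i : 'I_(fc_rk (colon_res u) k)) :
  exists2 s, (s <= off_supp u)%MM & fc_deg i = deg_mon s.
Proof. by have [g [_ H]] := projT2 (cid (colon_resolution_exists u)); apply: H. Qed.

Definition F_res k : fcomplex K n :=
  fc_dsum (fun u : mon_of_deg (@color_sqfree d m) k =>
    fc_shift (colon_res (mon_val u)) (- (deg_mon (mon_val u) *+ 2))).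

Lemma F_resP k : exists g : 'I_(fc_rk (F_res k) 0) -> F_ I' k, minimal_free_resolution g.
Proof.
pose g (u : mon_of_deg (@color_sqfree d m) k) := projT1 (cid (colon_resP (mon_val u))).
exists (dsum_aug (M := fun u : mon_of_deg (@color_sqfree d m) k => F_summand I' u) g).
apply: dsum_resolution => u; apply: shift_resolution.
exact: (projT2 (cid (colon_resP (mon_val u)))).
Qed.

Lemma ncells_F_res k (t : int) a : ncells (F_res k) t a =
  (\sum_(u : mon_of_deg (@color_sqfree d m) k)
     betti (gm_quot (mi_colon I' u)) t (a - deg_mon u *+ 2)%R)%N.
Proof.
rewrite ncells_dsum; apply: eq_bigr => u _; rewrite ncells_shift.
by have [g gmin] := colon_resP (mon_val u); rewrite (betti_ncells _ _ gmin).
Qed.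

Definition weight (a : zdeg n) : nat := #|[pred v | a v == 2 :> int]|.

(** The degrees of a resolution of [P/(I':u)] are squarefree and disjoint from
    [u], so that the shift by [2 deg u] makes the variables of [u] exactly those
    of exponent two. *)
Lemma F_resolution_weight k C (g : 'I_(fc_rk C 0) -> F_ I' k) :
  minimal_free_resolution g -> forall t (i : 'I_(fc_rk C t)), weight (fc_deg i) = k.
Proof.
move=> gmin t i; have [h hmin] := F_resP k.
(* The degree occurs in every minimal resolution, so also in the direct sum. *)
have : (0 < ncells (F_res k) t (fc_deg i))%N.
  rewrite -(betti_ncells _ _ hmin) (betti_ncells _ _ gmin) /=.
  by apply/card_gt0P; exists i; rewrite inE.
rewrite ncells_dsum lt0n sum_nat_eq0 => /forallPn[u]; rewrite negb_imply /=.
rewrite -lt0n => /card_gt0P[j]; rewrite inE => /eqP <-.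
have [s sN /= ->] := @colon_res_deg (mon_val u) t j.
have /andP[uc /eqP uk] := mon_of_degP u; have /andP[us _] := uc.
rewrite -[RHS]uk (sqfree_mdeg us); apply: eq_card => v; rewrite !inE.
rewrite opprK ffunE ffunMnE !ffunE.
have /mnm_lepP/(_ v) := sN; have /forallP/(_ v) := us; rewrite mnmE.
case: (mon_val u v) => [|[|]] //=; lia.
Qed.

Definition Fphi k : {linear F_seq I' (gm_quot (add_sq I)) k.+1 ->
    F_seq I' (gm_quot (add_sq I)) k} :=
  match k with
  | 0 => @Faug K d m I : {linear F_ I' 0 -> gm_quot (add_sq I)}
  | k'.+1 => @Fd K d m I k' : {linear F_ I' k'.+1 -> F_ I' k'}
  end.

End Terms.

Theorem proposition5p9 (K : fieldType) (d : nat) (m : 'I_d -> nat)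
    (hd : (1 <= d)%N) (I : monIdeal K (nvars m)) (hI : color_sqfree_ideal I) :
  let I' := add_br2 I in
  let M := gm_quot (add_sq I) in
  let E := F_seq I' M in
  (exists phi : forall k, {linear E k.+1 -> E k},
    [/\ [/\ forall k, gr_map (phi k),
          forall p, phi 0%N (koszul_proj I' (k := 0%N) [ffun=> p]) = mclass (add_sq I) p
        & forall k (z : koszul K m k.+1),
            phi k.+1 (koszul_proj I' z) = koszul_proj I' (koszul_d z)],
      [/\ forall x : E d.+1, phi d x = 0 -> x = 0,
          forall k, (k < d)%N -> forall x : E k.+1,
            phi k x = 0 <-> exists y : E k.+2, x = phi k.+1 y
        & forall y : E 0%N, exists x : E 1%N, y = phi 0%N x],
      exists iota : {linear gm_quot I' -> F_ I' 0},
        [/\ bijective iota, gr_map iota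
          & forall p, iota (mclass I' p) = koszul_proj I' [ffun=> p]]
    & forall (G : nat -> fcomplex K (nvars m))
        (gam : forall k, 'I_(fc_rk (G k) 0) -> E k.+1),
      (forall k, (k <= d)%N -> minimal_free_resolution (gam k)) ->
      (exists C (g : 'I_(fc_rk C 0) -> E 0%N), iterated_cone phi gam d g) /\
      (forall C (g : 'I_(fc_rk C 0) -> E 0%N),
        iterated_cone phi gam d g -> minimal_free_resolution g)]) /\
  (forall (k : int) (a : zdeg (nvars m)),
    betti M k a =
      (\sum_(j < d.+1) \sum_(u : mon_of_deg (@color_sqfree d m) j)
         betti (gm_quot (mi_colon I' u)) (k - j%:Z)%R (a - deg_mon u *+ 2)%R)%N).
Proof.
move=> I' M E.
pose phi : forall k, {linear E k.+1 -> E k} := @Fphi K d m I.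
have phih k : gr_map (phi k) by case: k => [|k]; [exact: Faug_gr_map|exact: Fd_gr_map].
have phi_exact k (x : E k.+1) : phi k x = 0 <-> exists y : E k.+2, x = phi k.+1 y.
  by case: k x => [|k] x; [exact: (Faug_exact hI)|exact: (Fd_exact hI)].
have phi_inj (x : E d.+1) : phi d x = 0 -> x = 0.
  by move=> /phi_exact[y ->]; rewrite (F_trivial y) raddf0.
have phi_surj (y : E 0%N) : exists x : E 1%N, y = phi 0%N x by apply: Faug_surj.
have cone_min (G : nat -> fcomplex K (nvars m)) (gam : forall k, 'I_(fc_rk (G k) 0) -> E k.+1) :
    (forall k, (k <= d)%N -> minimal_free_resolution (gam k)) ->
    (exists C (g : 'I_(fc_rk C 0) -> E 0%N), iterated_cone phi gam d g) /\
    (forall C (g : 'I_(fc_rk C 0) -> E 0%N),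
        iterated_cone phi gam d g -> minimal_free_resolution g).
  move=> Gmin; have exactd k (_ : (k < d)%N) := phi_exact k.
  split=> [|C g Cg].
    by have [C [g Cg]] := iterated_cone_exists phih phi_inj exactd Gmin (leq0n d); exists C, g.
  split; last first.
    apply: (iterated_cone_minimal Gmin (w := @weight d m)) Cg => k kd.
    exact: (F_resolution_weight hI (Gmin k kd)).
  apply: resolves_sub_iff (iterated_cone_resolves phih phi_inj exactd Gmin Cg) => x.
  by split.
split.
  exists phi; split=> //.
  - split=> // [p|k z]; last exact: Fd_proj.
    by rewrite /= Faug_proj ffunE.
  - by exists (@Fiota K d m I); split; [exact: Fiota_bij|exact: Fiota_gr_map|exact: Fiota_class].
move=> k a.
pose G := @F_res K d m I hI.
pose gam j : 'I_(fc_rk (G j) 0) -> E j.+1 := projT1 (cid (F_resP hI j)).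
have Gmin j : (j <= d)%N -> minimal_free_resolution (gam j).
  by move=> _; apply: (projT2 (cid (F_resP hI j))).
have [[C [g Cg]] /(_ _ _ Cg) gmin] := cone_min G gam Gmin.
rewrite (betti_ncells _ _ gmin) (ncells_iterated_cone Cg) subn0.
by apply: eq_bigr => j _; rewrite add0n ncells_F_res.
Qed.
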